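(* Let $X\subset\mathbb{R}^2$ be a planar self-affine set whose tuple of linear parts is dominated, with $s=\dim_{\mathrm{aff}}(X)\le1$. Then the maximum $\max_{V\in X_F}\mathcal{H}^s_\infty(\operatorname{proj}_{V^\perp}(X))$ exists and there is a constant $c>0$ such that $$\mathcal{H}^s(X)\le c\max_{V\in X_F}\mathcal{H}^s_\infty(\operatorname{proj}_{V^\perp}(X)).$$ In particular, if $\mathcal{H}^s(X)>0$, then $\inf_{V\in X_F}\mathcal{H}^s_\infty(\operatorname{proj}_{V^\perp}(X))>0$.
   Context: An affine iterated function system is a tuple $(\varphi_1,\dots,\varphi_N)$, $N\ge2$, with $\varphi_i(x)=A_ix+v_i$, $A_i\in GL_2(\mathbb{R})$, $\|A_i\|<1$; its self-affine set $X$ is the unique nonempty compact set with $X=\bigcup_i\varphi_i(X)$; properties of $\mathsf{A}=(A_1,\dots,A_N)$ are attributed to $X$. For $\mathtt{i}=i_1\cdots i_n$, $A_{\mathtt{i}}=A_{i_1}\cdots A_{i_n}$; $\Sigma_n$ words of length $n$, $\Sigma_*$ all finite words; $\alpha_1\ge\alpha_2$ singular values. Dominated: $\exists C>0,0<\tau<1$ with $\alpha_2(A_{\mathtt{i}})\le C\tau^{|\mathtt{i}|}\alpha_1(A_{\mathtt{i}})$ for all $\mathtt{i}\in\Sigma_*$. Singular value function $\varphi^s(A)=\alpha_1(A)^s$ ($0\le s\le1$), $\alpha_1(A)\alpha_2(A)^{s-1}$ ($1<s\le2$), $(\alpha_1\alpha_2)^{s/2}$ ($s>2$); $\dim_{\mathrm{aff}}(X)$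 is the unique $s\ge0$ with $\lim_n\frac1n\log\sum_{\mathtt{i}\in\Sigma_n}\varphi^s(A_{\mathtt{i}})=0$. Furstenberg directions: $X_F=\{A\mathbb{R}^2: A$ rank-one matrix in the closure of $\{cA_{i_1}^{-1}\cdots A_{i_n}^{-1}: c\in\mathbb{R}, i_1\cdots i_n\in\Sigma_*\}\}$. $\operatorname{proj}_W$ is orthogonal projection onto the line $W$. $\mathcal{H}^s$ is Hausdorff measure and $\mathcal{H}^s_\infty(Y)=\inf\{\sum_i\operatorname{diam}(U_i)^s: Y\subset\bigcup_iU_i\}$ is Hausdorff content. *)

(* Defs.v *)
From HB Require Import structures.
From mathcomp Require Import all_boot all_order all_algebra.
From mathcomp Require Import all_classical all_reals all_analysis.
Set Implicit Arguments. Unset Strict Implicit. Unset Printing Implicit Defensive.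
Import Order.TTheory GRing.Theory Num.Theory.
Import numFieldTopology.Exports numFieldNormedType.Exports.
Local Open Scope classical_set_scope.
Local Open Scope ring_scope.

Section Defs.
Variable R : realType.

Definition dot2 (x y : 'cV[R]_2) : R := \sum_(i < 2) x i 0 * y i 0.
Definition enorm2 (x : 'cV[R]_2) : R := Num.sqrt (dot2 x x).

Definition opnorm (A : 'M[R]_2) : R :=
  sup [set r | exists x : 'cV[R]_2, enorm2 x = 1 /\ r = enorm2 (A *m x)].

(* singular values alpha_1 >= alpha_2: square roots of the eigenvalues of A^T A,
   whose trace is the squared Frobenius norm and whose determinant is det(A)^2 *)
Definition frob2 (A : 'M[R]_2) : R := \sum_(i < 2) \sum_(j < 2) A i j ^+ 2.
Definition sv1 (A : 'M[R]_2) : R :=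
  Num.sqrt ((frob2 A + Num.sqrt (frob2 A ^+ 2 - 4 * (\det A) ^+ 2)) / 2).
Definition sv2 (A : 'M[R]_2) : R :=
  Num.sqrt ((frob2 A - Num.sqrt (frob2 A ^+ 2 - 4 * (\det A) ^+ 2)) / 2).

Definition svf (s : R) (A : 'M[R]_2) : R :=
  if s <= 1 then sv1 A `^ s
  else if s <= 2 then sv1 A * sv2 A `^ (s - 1)
  else (sv1 A * sv2 A) `^ (s / 2).

Variable N : nat.
Variable A : 'I_N -> 'M[R]_2.

Definition wordmx (w : seq 'I_N) : 'M[R]_2 := \prod_(i <- w) A i.

Definition dominated : Prop :=
  exists C tau : R, 0 < C /\ 0 < tau < 1 /\
    forall w : seq 'I_N,
      sv2 (wordmx w) <= C * tau ^+ size w * sv1 (wordmx w).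

Definition pressure_sum (s : R) (n : nat) : R :=
  \sum_(w : n.-tuple 'I_N) svf s (wordmx w).

Definition affdim_eq (s : R) : Prop :=
  (fun n : nat => n%:R^-1 * ln (pressure_sum s n) : R) @ \oo --> 0.

Definition is_affdim (s : R) : Prop :=
  0 <= s /\ affdim_eq s /\ forall t, 0 <= t -> affdim_eq t -> t = s.

Definition furst_mats : set 'M[R]_2 :=
  [set M | exists (c : R) (w : seq 'I_N), M = c *: \prod_(i <- w) (A i)^-1].

Definition furst_dirs : set (set 'cV[R]_2) :=
  [set V | exists M : 'M[R]_2, closure furst_mats M /\ \rank M = 1%N /\
           V = [set y | exists x, y = M *m x]].
End Defs.

Section Geom.
Variable R : realType.

Definition perp (V : set 'cV[R]_2) : set 'cV[R]_2 :=
  [set y | forall v, V v -> dot2 y v = 0].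

Definition orthproj (W : set 'cV[R]_2) (x : 'cV[R]_2) : 'cV[R]_2 :=
  xget 0 [set y | W y /\ forall w, W w -> dot2 (x - y) w = 0].

(* diameter (with diam of the empty set = 0) *)
Definition diam (U : set 'cV[R]_2) : \bar R :=
  ereal_sup ([set 0%E] `|`
    [set r | exists x y, U x /\ U y /\ r = (enorm2 (x - y))%:E]).

Definition is_cover (Y : set 'cV[R]_2) (U : nat -> set 'cV[R]_2) : Prop :=
  Y `<=` \bigcup_i U i.

Definition Hcontent (s : R) (Y : set 'cV[R]_2) : \bar R :=
  ereal_inf [set h | exists U, is_cover Y U /\
     h = (\sum_(0 <= i <oo) poweR (diam (U i)) s)%E].

Definition Hdelta (s d : R) (Y : set 'cV[R]_2) : \bar R :=
  ereal_inf [set h | exists U, is_cover Y U /\ (forall i, (diam (U i) <= d%:E)%E) /\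
     h = (\sum_(0 <= i <oo) poweR (diam (U i)) s)%E].

(* Hausdorff measure H^s = lim_{d -> 0} H^s_d = sup_{d > 0} H^s_d *)
Definition Hmeasure (s : R) (Y : set 'cV[R]_2) : \bar R :=
  ereal_sup [set h | exists d : R, 0 < d /\ h = Hdelta s d Y].
End Geom.

(* Main.v *)
(** Domination forces quasi-multiplicativity [k |A_u| |A_w| <= |A_uw|]: for unimodular products an
    orbit that is contracted both in the past and in the future would, read in the orthogonal frame
    it carries, give a triangular product with linearly growing norm, against domination.
    Together with zero pressure this makes [u |-> |A_u|^s] a Gibbs weight: its sums over the words
    of length [n] stay between positive constants.

    If [V] is a Furstenberg direction, some word [w] contracts [V] strongly, hence so do all
    [uw], and [phi_uw X] is covered by the images of the strips above a finite cover of
    the projection of [X] along [V], at cost about [|A_uw|^s] times its content. Stopping at the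
    first occurrence of [w] exhausts the Gibbs weight, so [H^s X] is at most a constant times the
    content of the projection, uniformly in [V]. The same finite covers survive small
    rotations of [V], so the content is upper semicontinuous on the compact space of directions
    and its maximum is attained. *)
Require Import Defs.
From HB Require Import structures.
From mathcomp Require Import all_boot all_order all_algebra.
From mathcomp Require Import all_classical all_reals all_analysis.
From mathcomp Require Import ring lra.
Set Implicit Arguments. Unset Strict Implicit. Unset Printing Implicit Defensive.
Import Order.TTheory GRing.Theory Num.Theory.
Import numFieldTopology.Exports numFieldNormedType.Exports.
Local Open Scope classical_set_scope.
Local Open Scope ring_scope.

(** * The Euclidean plane and the Frobenius norm *)

Section PlaneAlgebra.
Variable R : realType.
Implicit Types (x y z : 'cV[R]_2) (A B : 'M[R]_2).

(** The constant must be the same for all directions, although the contracting word [w], and the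
    share [beta] of the weight carried by its continuations, depend on the direction. Only the speed
    of the exhaustion sees [beta]: letting the number of stages grow leaves the factor [k ^- 2],
    where [k] depends on the system alone. No Gibbs measure is constructed. The total weight of the
    continuations of a word up to a finite horizon is additive over its children, which is all the
    exhaustion uses, and every cover stays finite.

    Quasi-multiplicativity enters twice: it compares weights of words with sums over their
    continuations, and it keeps the contraction relative to [|A_uw|] when a prefix [u] is added to
    [w]. Directions are represented by singular matrices of Frobenius norm one, a compact set of
    matrices that replaces a topology on lines. Since [N >= 2], zero pressure forces [s > 0], so
    empty sets cost nothing in a cover and thickening can be measured through [s]-th powers. *)

Lemma sum2E (f : 'I_2 -> R) : \sum_(i < 2) f i = f 0 + f 1.
Proof.
by rewrite !big_ord_recl big_ord0 addr0; congr (_ + f _); apply/val_inj.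
Qed.

Lemma ord2_ind (P : 'I_2 -> Prop) : P 0 -> P 1 -> forall i, P i.
Proof.
move=> P0 P1 [[|[|//]] lti]; [rewrite (_ : Ordinal _ = 0)|rewrite (_ : Ordinal _ = 1)] => //;
  exact/val_inj.
Qed.

Lemma col2P x y : x 0 0 = y 0 0 -> x 1 0 = y 1 0 -> x = y.
Proof.
by move=> e0 e1; apply/matrixP => i j; rewrite (ord1 j); move: i; apply: ord2_ind.
Qed.

Lemma mulmx2E A x i : (A *m x) i 0 = A i 0 * x 0 0 + A i 1 * x 1 0.
Proof. by rewrite mxE sum2E. Qed.

Lemma dot2E x y : dot2 x y = x 0 0 * y 0 0 + x 1 0 * y 1 0.
Proof. by rewrite /dot2 sum2E. Qed.

Lemma frob2E A :
  frob2 A = A 0 0 ^+ 2 + A 0 1 ^+ 2 + A 1 0 ^+ 2 + A 1 1 ^+ 2.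
Proof. by rewrite /frob2 sum2E !sum2E addrA. Qed.

Lemma det2E A : \det A = A 0 0 * A 1 1 - A 0 1 * A 1 0.
Proof.
have l0 : lift 0 0 = 1 :> 'I_2 by exact/val_inj.
have l1 : lift 1 0 = 0 :> 'I_2 by exact/val_inj.
rewrite (expand_det_row A 0) sum2E /cofactor !det_mx11 !mxE l0 l1 /=.
by rewrite /= expr0 expr1 mul1r mulN1r mulrN.
Qed.

(** Signed area spanned by [x] and [y]. By [wedge_mulmx] unimodular matrices preserve its absolute
    value, which makes it the measure of transversality of two orbits. *)
Definition wedge x y : R := x 0 0 * y 1 0 - x 1 0 * y 0 0.

Definition rot x : 'cV[R]_2 := \col_i (if i == 0 then - x 1 0 else x 0 0).

Lemma rotE0 x : rot x 0 0 = - x 1 0. Proof. by rewrite mxE. Qed.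
Lemma rotE1 x : rot x 1 0 = x 0 0. Proof. by rewrite mxE. Qed.

Definition coordE := (mulmx2E, dot2E, rotE0, rotE1, frob2E, det2E).

Lemma wedge_mulmx A x y : wedge (A *m x) (A *m y) = \det A * wedge x y.
Proof. rewrite /wedge !coordE; ring. Qed.

Local Notation nrm := (@enorm2 R).

Lemma dot2Dl x y z : dot2 (x + y) z = dot2 x z + dot2 y z.
Proof. by rewrite !dot2E !mxE; ring. Qed.

Lemma dot2Zl (a : R) x y : dot2 (a *: x) y = a * dot2 x y.
Proof. by rewrite !dot2E !mxE; ring. Qed.

Lemma dot2C x y : dot2 x y = dot2 y x.
Proof. by rewrite !dot2E; ring. Qed.

Lemma dot2xx_ge0 x : 0 <= dot2 x x.
Proof. by rewrite dot2E addr_ge0 // -expr2 sqr_ge0. Qed.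

Lemma enorm2_ge0 x : 0 <= nrm x. Proof. exact: sqrtr_ge0. Qed.

Lemma enorm2_sqr x : nrm x ^+ 2 = dot2 x x.
Proof. by rewrite sqr_sqrtr ?dot2xx_ge0. Qed.

Lemma enorm2_sqrE x : nrm x ^+ 2 = x 0 0 ^+ 2 + x 1 0 ^+ 2.
Proof. by rewrite enorm2_sqr dot2E -!expr2. Qed.

Lemma enorm2_le x (a : R) : 0 <= a -> dot2 x x <= a ^+ 2 -> nrm x <= a.
Proof.
by move=> a0 h; rewrite -(@ler_pXn2r _ 2) ?nnegrE ?enorm2_ge0 // enorm2_sqr.
Qed.

Lemma enorm2_eq0 x : nrm x = 0 -> x = 0.
Proof.
move=> h; have := enorm2_sqrE x; rewrite h expr0n /= => /esym/eqP.
rewrite paddr_eq0 ?sqr_ge0 // !sqrf_eq0 => /andP[/eqP x0 /eqP x1].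
by apply: col2P; rewrite ?x0 ?x1 mxE.
Qed.

Lemma enorm2_gt0 x : (0 < nrm x) = (x != 0).
Proof.
rewrite lt_def enorm2_ge0 andbT; congr (~~ _); apply/eqP/eqP => [/enorm2_eq0//|->].
by rewrite /enorm2 dot2E !mxE !mulr0 addr0 sqrtr0.
Qed.

Lemma enorm20 : nrm 0 = 0.
Proof. by apply/eqP; have := enorm2_gt0 0; rewrite eqxx lt_def enorm2_ge0 andbT => /negbFE. Qed.

Lemma enorm2Z (a : R) x : nrm (a *: x) = `|a| * nrm x.
Proof.
rewrite /enorm2 -sqrtr_sqr -sqrtrM ?sqr_ge0 //; congr Num.sqrt.
by rewrite !dot2E !mxE; ring.
Qed.

Lemma enorm2N x : nrm (- x) = nrm x.
Proof. by rewrite -scaleN1r enorm2Z normrN1 mul1r. Qed.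

Lemma enorm2_rot x : nrm (rot x) = nrm x.
Proof. by rewrite /enorm2 !coordE; congr Num.sqrt; ring. Qed.

(** Lagrange's identity; the bounds [dot2_le] and [wedge_le] each drop one square. *)
Lemma dot2_wedge x y :
  dot2 x y ^+ 2 + wedge x y ^+ 2 = (nrm x * nrm y) ^+ 2.
Proof. by rewrite exprMn !enorm2_sqrE dot2E /wedge; ring. Qed.

Lemma dot2_le x y : `|dot2 x y| <= nrm x * nrm y.
Proof.
rewrite -(@ler_pXn2r _ 2) ?nnegrE ?mulr_ge0 ?enorm2_ge0 //.
by rewrite -dot2_wedge -normrX ger0_norm ?sqr_ge0 // lerDl sqr_ge0.
Qed.

Lemma wedge_le x y : `|wedge x y| <= nrm x * nrm y.
Proof.
rewrite -(@ler_pXn2r _ 2) ?nnegrE ?mulr_ge0 ?enorm2_ge0 //.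
by rewrite -dot2_wedge -normrX ger0_norm ?sqr_ge0 // lerDr sqr_ge0.
Qed.

Lemma enorm2D x y : nrm (x + y) <= nrm x + nrm y.
Proof.
apply: enorm2_le; first by rewrite addr_ge0 ?enorm2_ge0.
have := le_trans (ler_norm _) (dot2_le x y).
rewrite sqrrD !enorm2_sqrE !dot2E !mxE; lra.
Qed.

Lemma enorm2_coord_le x : nrm x <= `|x 0 0| + `|x 1 0|.
Proof.
apply: enorm2_le; first by rewrite addr_ge0.
have := mulr_ge0 (normr_ge0 (x 0 0)) (normr_ge0 (x 1 0)).
rewrite sqrrD !real_normK ?num_real // dot2E !expr2; lra.
Qed.

Lemma decomp_rot x y : y != 0 ->
  x = (dot2 x y / nrm y ^+ 2) *: y + (wedge y x / nrm y ^+ 2) *: rot y.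
Proof.
rewrite -enorm2_gt0 => y0.
have h : y 0 0 ^+ 2 + y 1 0 ^+ 2 != 0 by rewrite -enorm2_sqrE expf_neq0 ?gt_eqF.
rewrite enorm2_sqrE; apply: col2P; rewrite !mxE /= dot2E /wedge; by field.
Qed.

(** This norm stands in for the operator norm and for [sv1]: it is comparable to both,
    submultiplicative, and its square is a polynomial in the entries. *)
Definition frob A : R := Num.sqrt (frob2 A).

Lemma frob2_ge0 A : 0 <= frob2 A.
Proof. by rewrite frob2E !addr_ge0 ?sqr_ge0. Qed.

Lemma frob_ge0 A : 0 <= frob A. Proof. exact: sqrtr_ge0. Qed.

Lemma frob_sqr A : frob A ^+ 2 = frob2 A.
Proof. by rewrite sqr_sqrtr ?frob2_ge0. Qed.

Lemma frobZ (a : R) A : frob (a *: A) = `|a| * frob A.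
Proof.
rewrite /frob -sqrtr_sqr -sqrtrM ?sqr_ge0 //; congr Num.sqrt.
by rewrite !frob2E !mxE; ring.
Qed.

Lemma enorm2_mulmx A x : nrm (A *m x) <= frob A * nrm x.
Proof.
apply: enorm2_le; first by rewrite mulr_ge0 ?enorm2_ge0 ?frob_ge0.
rewrite exprMn frob_sqr enorm2_sqrE !coordE -subr_ge0.
rewrite [leRHS](_ : _ = (A 0 0 * x 1 0 - A 0 1 * x 0 0) ^+ 2 +
  (A 1 0 * x 1 0 - A 1 1 * x 0 0) ^+ 2); last by ring.
by rewrite addr_ge0 ?sqr_ge0.
Qed.

Lemma delta_norm (k : 'I_2) : nrm (delta_mx k 0) = 1.
Proof.
rewrite /enorm2 dot2E -[RHS]sqrtr1; congr Num.sqrt; move: k; apply: ord2_ind;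
  by rewrite !mxE /=; ring.
Qed.

Lemma frob2_cols A :
  frob2 A = nrm (A *m delta_mx 0 0) ^+ 2 + nrm (A *m delta_mx 1 0) ^+ 2.
Proof. by rewrite !enorm2_sqrE !coordE !mxE /=; ring. Qed.

Lemma frob_mul A B : frob (A *m B) <= frob A * frob B.
Proof.
rewrite -(@ler_pXn2r _ 2) ?nnegrE ?mulr_ge0 ?frob_ge0 //.
rewrite exprMn !frob_sqr (frob2_cols (_ *m _)) (frob2_cols B) mulrDr.
by rewrite -frob_sqr -!exprMn -!mulmxA lerD // lerXn2r ?nnegrE
  ?mulr_ge0 ?enorm2_ge0 ?frob_ge0 // enorm2_mulmx.
Qed.

Lemma frob_le_cols A (K : R) :
  (forall x, nrm x = 1 -> nrm (A *m x) <= K) -> frob A <= 2 * K.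
Proof.
move=> h; have K0 : 0 <= K by apply: le_trans (h _ (delta_norm 0)); apply: enorm2_ge0.
rewrite -(@ler_pXn2r _ 2) ?nnegrE ?mulr_ge0 ?frob_ge0 //.
rewrite frob_sqr frob2_cols exprMn.
have h1 k : nrm (A *m delta_mx k 0) ^+ 2 <= K ^+ 2.
  by rewrite lerXn2r ?nnegrE ?enorm2_ge0 // h ?delta_norm.
by have := h1 0; have := h1 1; have := sqr_ge0 K; lra.
Qed.

(** The longer of the two columns carries at least half of the squared norm. *)
Lemma frob_attained A : exists2 x, nrm x = 1 & frob A <= 2 * nrm (A *m x).
Proof.
pose a := nrm (A *m delta_mx 0 0); pose b := nrm (A *m delta_mx 1 0).
have [ab|ba] := leP a b; [exists (delta_mx 1 0)|exists (delta_mx 0 0)];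
  rewrite ?delta_norm //; apply: le_trans (_ : Num.sqrt (a ^+ 2 + b ^+ 2) <= _);
  rewrite /frob ?frob2_cols // -(@ler_pXn2r _ 2) ?nnegrE ?mulr_ge0 ?enorm2_ge0 ?sqrtr_ge0 //
   sqr_sqrtr ?addr_ge0 ?sqr_ge0 // exprMn; have := enorm2_ge0 (A *m delta_mx 0 0);
  have := enorm2_ge0 (A *m delta_mx 1 0); rewrite -/a -/b; nra.
Qed.

Lemma det_frob A : 2 * `|\det A| <= frob2 A.
Proof.
rewrite -[X in X * _]ger0_norm // -normrM ler_norml det2E frob2E.
have := sqr_ge0 (A 0 0 + A 1 1); have := sqr_ge0 (A 0 0 - A 1 1).
have := sqr_ge0 (A 0 1 + A 1 0); have := sqr_ge0 (A 0 1 - A 1 0).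
rewrite !sqrrD !sqrrN; lra.
Qed.

(** In dimension two the adjugate permutes the entries up to sign, so it has the same norm as [A].
    In particular unimodular words and their inverses have equal norms. *)
Lemma frob_invmx A : A \in unitmx -> frob (invmx A) = `|\det A|^-1 * frob A.
Proof.
move=> u; have d0 : \det A != 0 by move: u; rewrite unitmxE unitfE.
have -> : invmx A = (\det A)^-1 *: \matrix_(i, j)
    (if i == 0 then (if j == 0 then A 1 1 else - A 0 1)
     else (if j == 0 then - A 1 0 else A 0 0)).
  apply: (can_inj (mulKmx u)); rewrite mulmxV // -scalemxAr.
  apply: (can_inj (scalerK d0)); rewrite scalerA mulfV // scale1r.
  apply/matrixP; apply: ord2_ind; apply: ord2_ind;
    by rewrite !mxE sum2E !mxE /= det2E; ring.
rewrite frobZ normfV; congr (_ * _); rewrite /frob !frob2E !mxE /=; congr Num.sqrt; ring.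
Qed.

Lemma coord_le_frob A i j : `|A i j| <= frob A.
Proof.
rewrite -(@ler_pXn2r _ 2) ?nnegrE ?frob_ge0 // frob_sqr real_normK ?num_real // frob2E.
have h k l := sqr_ge0 (A k l).
move: i j; apply: ord2_ind; apply: ord2_ind; have := h 0 0; have := h 0 1;
  have := h 1 0; have := h 1 1; lra.
Qed.

Lemma frobD A B : frob (A + B) <= frob A + frob B.
Proof.
rewrite -(@ler_pXn2r _ 2) ?nnegrE ?addr_ge0 ?frob_ge0 // sqrrD !frob_sqr.
pose c := A 0 0 * B 0 0 + A 0 1 * B 0 1 + A 1 0 * B 1 0 + A 1 1 * B 1 1.
have hc : c <= frob A * frob B.
  apply: le_trans (ler_norm _) _.
  rewrite -(@ler_pXn2r _ 2) ?nnegrE ?mulr_ge0 ?frob_ge0 // real_normK ?num_real //.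
  rewrite exprMn !frob_sqr !frob2E -subr_ge0.
  rewrite [leRHS](_ : _ = (A 0 0 * B 0 1 - A 0 1 * B 0 0) ^+ 2 +
    (A 0 0 * B 1 0 - A 1 0 * B 0 0) ^+ 2 + (A 0 0 * B 1 1 - A 1 1 * B 0 0) ^+ 2 +
    (A 0 1 * B 1 0 - A 1 0 * B 0 1) ^+ 2 + (A 0 1 * B 1 1 - A 1 1 * B 0 1) ^+ 2 +
    (A 1 0 * B 1 1 - A 1 1 * B 1 0) ^+ 2); first by rewrite !addr_ge0 ?sqr_ge0.
  by rewrite /c; ring.
have -> : frob2 (A + B) = frob2 A + c *+ 2 + frob2 B by rewrite !frob2E !mxE /c; ring.
by rewrite lerD2r lerD2l lerMn2r hc.
Qed.

Lemma frobN A : frob (- A) = frob A.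
Proof. by rewrite -scaleN1r frobZ normrN1 mul1r. Qed.

Lemma frob_gt0 A : (0 < frob A) = (A != 0).
Proof.
rewrite lt_def frob_ge0 andbT; congr (~~ _); apply/eqP/eqP => [h|->].
  apply/matrixP => i j; apply/eqP; rewrite mxE -normr_le0 -h; exact: coord_le_frob.
by rewrite -(scale0r 0) frobZ normr0 mul0r.
Qed.

(** The determinant is the [wedge] of the columns, which is bilinear, so the columns can be
    exchanged one at a time. *)
Lemma det_dist_le A B : `|\det A - \det B| <= frob (A - B) * (frob A + frob B).
Proof.
have le_col C (k : 'I_2) : nrm (C *m delta_mx k 0) <= frob C.
  by have := enorm2_mulmx C (delta_mx k 0); rewrite delta_norm mulr1.
rewrite (_ : _ - _ = wedge ((A - B) *m delta_mx 0 0) (A *m delta_mx 1 0) +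
  wedge (B *m delta_mx 0 0) ((A - B) *m delta_mx 1 0)); last first.
  by rewrite /wedge !coordE !mxE /=; ring.
apply: le_trans (ler_normD _ _) _; rewrite mulrDr lerD //.
  by apply: le_trans (wedge_le _ _) _; apply: ler_pM; rewrite ?enorm2_ge0.
by apply: le_trans (wedge_le _ _) _; rewrite mulrC; apply: ler_pM; rewrite ?enorm2_ge0.
Qed.

End PlaneAlgebra.

(** * Quasi-multiplicativity of unimodular products *)

Section Words.
Variables (R : realType) (N : nat).
Implicit Types (B : 'I_N -> 'M[R]_2) (u w : seq 'I_N) (x v : 'cV[R]_2).
Local Notation nrm := (@enorm2 R).

Lemma wordmx_nil B : wordmx B [::] = 1%:M.
Proof. by rewrite /wordmx big_nil. Qed.

Lemma wordmx_cons B i w : wordmx B (i :: w) = B i *m wordmx B w.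
Proof. by rewrite /wordmx big_cons. Qed.

Lemma wordmx_cat B u w : wordmx B (u ++ w) = wordmx B u *m wordmx B w.
Proof. by rewrite /wordmx big_cat. Qed.

Lemma wordmx_det_neq0 B w : (forall i, \det (B i) != 0) -> \det (wordmx B w) != 0.
Proof.
move=> hB; elim: w => [|i w ih]; first by rewrite wordmx_nil det1 oner_eq0.
by rewrite wordmx_cons det_mulmx mulf_neq0.
Qed.

(** Bernoulli's inequality alone gives linear growth; applied to the square root of [l] and squared,
    it gives quadratic growth. *)
Lemma exp_beats_linear (c l K : R) : 0 < c -> 1 < l ->
  exists n1, forall n, (n1 <= n)%N -> K * (1 + n%:R) < c * l ^+ n.
Proof.
move=> c0 l1; have l0 : 0 <= l by lra.
have m1 : 1 < Num.sqrt l by rewrite -sqrtr1 ltr_sqrt //; lra.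
pose h := Num.min 1 (Num.sqrt l - 1).
have h0 : 0 < h by rewrite lt_min ltr01 subr_gt0.
have h1 : h <= 1 by rewrite ge_min lexx.
have hm : 1 + h <= Num.sqrt l.
  by rewrite -lerBrDl ge_min lexx orbT.
have bern n : 1 + n%:R * h <= (1 + h) ^+ n.
  elim: n => [|n ih]; first by rewrite mul0r expr0 addr0.
  rewrite exprS -natr1; apply: le_trans (ler_wpM2l _ ih); last by lra.
  have : 0 <= n%:R * h * h by rewrite !mulr_ge0 // ltW.
  lra.
exists (Num.truncn (`|K| / (c * h * h))).+1 => n hn.
have hnK : `|K| < c * h * (n%:R * h).
  have d0 : 0 < c * h * h by rewrite !mulr_gt0.
  have : `|K| / (c * h * h) < n%:R.
    apply: lt_le_trans (truncnS_gt _) _; by rewrite ler_nat.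
  by rewrite ltr_pdivrMr // => ?; rewrite (_ : c * h * (n%:R * h) = n%:R * (c * h * h)) //; ring.
have n0 : 0 <= n%:R :> R by [].
have hl : l ^+ n = (Num.sqrt l ^+ n) * (Num.sqrt l ^+ n).
  by rewrite -expr2 -exprM mulnC exprM sqr_sqrtr.
have hp : 1 + n%:R * h <= Num.sqrt l ^+ n.
  apply: le_trans (bern n) _; rewrite lerXn2r ?nnegrE ?sqrtr_ge0 //; lra.
have nh : 0 <= n%:R * h by rewrite mulr_ge0 // ltW.
apply: lt_le_trans (_ : c * ((1 + n%:R * h) * (1 + n%:R * h)) <= _).
  have e1 : h * (1 + n%:R) <= 1 + n%:R * h by lra.
  apply: lt_le_trans (_ : c * (h * (1 + n%:R) * (n%:R * h)) <= _).
    rewrite (_ : c * _ = c * h * (n%:R * h) * (1 + n%:R)); last by ring.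
    rewrite ltr_pM2r; last lra.
    by apply: le_lt_trans hnK; apply: ler_norm.
  rewrite ler_pM2l // ler_pM //; first by rewrite mulr_ge0 // ?ltW //; lra.
  lra.
by rewrite ler_pM2l // hl ler_pM //; lra.
Qed.

(** Levi's lemma for two factorisations of one word. *)
Lemma eq_cat_split (T : Type) (u w p q : seq T) : u ++ w = p ++ q ->
  (exists r, w = r ++ q) \/ (exists2 r, u = p ++ r & q = r ++ w).
Proof.
elim: u p => [|a u ih] [|a' p] /=; [by left; exists [::]|by left; exists (a' :: p)| |].
  by right; exists (a :: u).
by move=> [-> /ih[[r ->]|[r -> ->]]]; [left; exists r|right; exists r].
Qed.

Section Unimodular.
Variables (B : 'I_N -> 'M[R]_2) (b : R).
Hypothesis b1 : 1 <= b.
Hypothesis detB : forall i, `|\det (B i)| = 1.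
Hypothesis frobB : forall i, frob (B i) <= b.

Local Notation M := (wordmx B).

Let b0 : 0 < b. Proof. exact: lt_le_trans b1. Qed.

Lemma word_det1 w : `|\det (M w)| = 1.
Proof.
elim: w => [|i w ih]; first by rewrite wordmx_nil det1 normr1.
by rewrite wordmx_cons det_mulmx normrM ih detB mulr1.
Qed.

Lemma word_neq0 w v : v != 0 -> M w *m v != 0.
Proof.
move=> v0; apply: contra_neq v0 => h.
have u : M w \in unitmx by rewrite unitmxE unitfE -normr_gt0 word_det1.
by rewrite -(mulKmx u v) h mulmx0.
Qed.

Lemma letter_le i x : nrm (B i *m x) <= b * nrm x.
Proof.
by apply: le_trans (enorm2_mulmx _ _) _; rewrite ler_wpM2r ?enorm2_ge0.
Qed.

(** The square on [x] and [rot x] keeps its area, and the image of [rot x] has length at most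
    [b |x|], so the image of [x] cannot be too short. *)
Lemma letter_ge i x : nrm x <= b * nrm (B i *m x).
Proof.
have [->|x0] := eqVneq x 0.
  by rewrite enorm20 mulr_ge0 ?enorm2_ge0 // ltW.
have n0 : 0 < nrm x by rewrite enorm2_gt0.
have : nrm x ^+ 2 <= nrm (B i *m x) * (b * nrm x).
  have -> : nrm x ^+ 2 = `|wedge x (rot x)|.
    rewrite enorm2_sqrE /wedge rotE0 rotE1 ger0_norm; first by ring.
    by rewrite mulrN opprK -!expr2 addr_ge0 ?sqr_ge0.
  rewrite -[leLHS]mul1r -(detB i) -normrM -wedge_mulmx.
  apply: le_trans (wedge_le _ _) _; rewrite ler_wpM2l ?enorm2_ge0 //.
  by rewrite -(enorm2_rot x) letter_le.
by rewrite expr2 mulrA ler_pM2r // mulrC.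
Qed.

Lemma word_le w x : nrm (M w *m x) <= b ^+ size w * nrm x.
Proof.
elim: w => [|i w ih]; first by rewrite wordmx_nil mul1mx mul1r.
rewrite wordmx_cons -mulmxA; apply: le_trans (letter_le _ _) _.
by rewrite exprS -mulrA ler_pM2l.
Qed.

(* Writing [B_w x] in the orthogonal frame carried by the orbit of [v] makes the
   cocycle triangular; the off-diagonal entries add up instead of multiplying. *)
Lemma triangular_bound (v : 'cV[R]_2) (m : R) w : 0 < m ->
  (forall u1 u2, w = u1 ++ u2 -> m <= nrm (M u2 *m v)) ->
  forall x, nrm (M w *m x) <= nrm x * (nrm (M w *m v) / nrm v +
     nrm v / nrm (M w *m v) + b * (size w)%:R * nrm v * nrm (M w *m v) / m ^+ 2).
Proof.
move=> m0 hm x.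
have vm : m <= nrm v by have := hm w [::] (esym (cats0 w)); rewrite wordmx_nil mul1mx.
have v0 : v != 0 by rewrite -enorm2_gt0 (lt_le_trans m0).
have nv0 : 0 < nrm v by rewrite enorm2_gt0.
pose om := nrm x * nrm v.
have om0 : 0 <= om by rewrite mulr_ge0 ?enorm2_ge0.
have hom u : `|wedge (M u *m v) (M u *m x)| <= om.
  by rewrite wedge_mulmx normrM word_det1 mul1r /om mulrC wedge_le.
(* The left side is the coefficient of the image of [x] along the orbit of [v]. A letter preserves
   this coefficient except for a transfer from the orthogonal component, which is controlled by the
   preserved area and is at most [om * b / m ^+ 2]. *)
have key : `|dot2 (M w *m x) (M w *m v)| / nrm (M w *m v) ^+ 2 <=
   nrm x / nrm v + om * b * (size w)%:R / m ^+ 2.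
  elim: w hm => [|i w ih] hm.
    rewrite wordmx_nil !mul1mx mulr0 mul0r addr0 ler_pdivrMr ?exprn_gt0 //.
    by apply: le_trans (dot2_le _ _) _; rewrite expr2 mulrA divfK // gt_eqF.
  have {}ih := ih (fun u1 u2 e => hm (i :: u1) u2 (congr1 (cons i) e)).
  set y := M w *m v in ih *; set z := M w *m x in ih *.
  have y0 : y != 0 by exact: word_neq0.
  have ny0 : 0 < nrm y by rewrite enorm2_gt0.
  rewrite !wordmx_cons -!mulmxA -/y -/z.
  have ny : m <= nrm y := hm [:: i] w erefl.
  have nCy : m <= nrm (B i *m y).
    by have := hm [::] (i :: w) erefl; rewrite wordmx_cons -mulmxA.
  have nCy0 : 0 < nrm (B i *m y) by exact: lt_le_trans nCy.
  set t := dot2 z y / nrm y ^+ 2; set o := wedge y z / nrm y ^+ 2.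
  have ez : z = t *: y + o *: rot y by exact: decomp_rot.
  have ed : dot2 (B i *m z) (B i *m y) =
      t * nrm (B i *m y) ^+ 2 + o * dot2 (B i *m rot y) (B i *m y).
    by rewrite {1}ez mulmxDr -!scalemxAr dot2Dl !dot2Zl enorm2_sqr.
  rewrite ed; apply: le_trans (_ : `|t| + om * b / m ^+ 2 <= _); last first.
    have -> : `|t| = `|dot2 z y| / nrm y ^+ 2.
      by rewrite normrM [`|_^-1|]ger0_norm // invr_ge0 exprn_ge0 ?enorm2_ge0.
    rewrite /= -natr1 mulrDr mulr1 mulrDl addrA lerD2r.
    exact: ih.
  rewrite ler_pdivrMr ?exprn_gt0 // mulrDl; apply: le_trans (ler_normD _ _) _.
  rewrite normrM [`|_ ^+ 2|]ger0_norm ?exprn_ge0 ?enorm2_ge0 // lerD2l.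
  rewrite normrM; apply: le_trans (_ : om / nrm y ^+ 2 * (b * nrm y * nrm (B i *m y)) <= _).
    rewrite ler_pM //.
      rewrite /o normrM [`|_^-1|]ger0_norm ?invr_ge0 ?exprn_ge0 ?enorm2_ge0 //.
      by rewrite ler_wpM2r ?invr_ge0 ?exprn_ge0 ?enorm2_ge0 // hom.
    apply: le_trans (dot2_le _ _) _; rewrite ler_wpM2r ?enorm2_ge0 //.
    by rewrite -(enorm2_rot y) letter_le.
  set p := nrm y in ny ny0 *; set q := nrm (B i *m y) in nCy nCy0 *.
  have -> : om / p ^+ 2 * (b * p * q) = om * b * q ^+ 2 * (p * q)^-1.
    by field; rewrite !gt_eqF.
  rewrite [leRHS](_ : _ = om * b * q ^+ 2 * (m * m)^-1); last first.
    by field; rewrite gt_eqF.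
  apply: ler_wpM2l.
    by apply: mulr_ge0; [apply: mulr_ge0; rewrite ?(ltW b0)|apply: sqr_ge0].
  by rewrite lef_pV2 ?posrE ?mulr_gt0 // ler_pM ?(ltW m0).
have y0 : M w *m v != 0 by exact: word_neq0.
have ny0 : 0 < nrm (M w *m v) by rewrite enorm2_gt0.
rewrite {1}(decomp_rot (M w *m x) y0); apply: le_trans (enorm2D _ _) _.
rewrite !enorm2Z enorm2_rot !normrM ![`|_^-1|]ger0_norm ?invr_ge0 ?exprn_ge0 ?enorm2_ge0 //.
have h2 := hom w.
set p := nrm (M w *m v) in key ny0 *.
apply: le_trans (_ : (nrm x / nrm v + om * b * (size w)%:R / m ^+ 2) * p + om / p ^+ 2 * p <= _).
  by rewrite lerD // ler_wpM2r ?(ltW ny0) // ler_wpM2r ?invr_ge0 ?exprn_ge0 ?(ltW ny0).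
rewrite le_eqVlt; apply/orP; left; apply/eqP; rewrite /om; field.
by rewrite !gt_eqF.
Qed.

(** A word acts on a vector from its last letter, so suffixes are times along the orbit. The
    induction keeps [z] as the longest suffix, that is the latest time, at which the norm is at most
    [t]. *)
Lemma last_below (t : R) (v : 'cV[R]_2) w : nrm v <= t ->
  exists u z, [/\ w = u ++ z, nrm (M z *m v) <= t &
    forall u1 u2, u = u1 ++ u2 -> u2 != [::] -> t < nrm (M (u2 ++ z) *m v)].
Proof.
move=> vt; elim: w => [|i w [u [z [ew zt hu]]]].
  by exists [::], [::]; split; rewrite ?wordmx_nil ?mul1mx // => -[|//] [|//].
have [le|lt] := leP (nrm (M (i :: w) *m v)) t.
  by exists [::], (i :: w); split=> // -[|//] [|//] _.
exists (i :: u), z; split; rewrite ?ew // => -[|j u1] u2 e u20.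
  by move: e => /= <-; rewrite /= -ew.
by move: e => [_ e]; exact: hu e u20.
Qed.

(** The induction detects the first time the norm falls to [t]; by [letter_ge] the one step that
    crosses the level loses at most a factor [b]. *)
Lemma first_below (t : R) (y : 'cV[R]_2) w : t < nrm y -> nrm (M w *m y) <= t ->
  exists u, nrm (M u *m y) <= t /\
    forall u1 u2, u = u1 ++ u2 -> t <= b * nrm (M u2 *m y).
Proof.
move=> ty.
pose good u := nrm (M u *m y) <= t /\
    forall u1 u2, u = u1 ++ u2 -> t <= b * nrm (M u2 *m y).
have lb u : t < nrm (M u *m y) -> t <= b * nrm (M u *m y).
  by move=> /ltW h; apply: le_trans h _; rewrite ler_peMl ?enorm2_ge0.
suff : (exists u, good u) \/ forall u1 u2, w = u1 ++ u2 -> t < nrm (M u2 *m y).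
  by move=> [//|/(_ [::] w erefl)]; rewrite ltNge => /negP h /h.
elim: w => [|i w [ih|ih]]; [|by left|].
  by right=> -[|//] [|//] _; rewrite wordmx_nil mul1mx.
have [le|lt] := leP (nrm (M (i :: w) *m y)) t; last first.
  by right=> -[|j u1] u2; [move=> /= <-|move=> [_]; exact: ih].
left; exists (i :: w); split=> // -[|j u1] u2; last by move=> [_ /ih/lb].
move=> /= <-; apply: le_trans (ltW (ih [::] w erefl)) _.
by rewrite wordmx_cons -mulmxA letter_ge.
Qed.

Variables (c l : R).
Hypotheses (c0 : 0 < c) (l1 : 1 < l).
Hypothesis growth : forall w, c * l ^+ size w <= frob (M w).

(* Otherwise the orbit would enter and leave the level [eps * |B_w1 v|] with comparable
   norms, and [triangular_bound] would make the product over that time window grow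
   only linearly in its length. *)
Lemma no_hump : exists2 eps : R, 0 < eps & forall w2 w1 (v : 'cV[R]_2),
  nrm v < eps * nrm (M w1 *m v) ->
  eps * nrm (M w1 *m v) <= nrm (M (w2 ++ w1) *m v).
Proof.
(* In [triangular_bound] both ratios of the end norms will be at most [b] and the last term at most
   [b ^+ 3] times the length; the outer 2 is that of [frob_le_cols]. *)
have [n1 hn1] := exp_beats_linear (2 * (2 * b + b ^+ 3)) c0 l1.
have bn0 : 0 < b ^+ n1 by rewrite exprn_gt0.
(* With this [eps], climbing from level [t] to [|y| = 2 * b ^+ n1 * t] takes more than [n1] letters,
   while linear growth forces the window to be shorter. *)
exists (2 * b ^+ n1)^-1; first by rewrite invr_gt0 mulr_gt0.
set eps := _^-1 => w2 w1 v; set y := M w1 *m v; set t := eps * nrm y => hv.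
have e0 : 0 < eps by rewrite invr_gt0 mulr_gt0.
rewrite leNgt; apply/negP => hz.
have t0 : 0 < t by apply: le_lt_trans hv; apply: enorm2_ge0.
have y0 : 0 < nrm y by move: t0; rewrite pmulr_rgt0.
have bn1 : 1 <= b ^+ n1 by apply: exprn_ege1.
have ty : t < nrm y.
  rewrite /t gtr_pMl // /eps invf_lt1; lra.
have [u1 [z1 [ew1 z1t hu1]]] := last_below w1 (ltW hv).
have [u2 [u2t hu2]] : exists u, nrm (M u *m y) <= t /\
    forall u1 u2, u = u1 ++ u2 -> t <= b * nrm (M u2 *m y).
  by apply: (first_below (w := w2)) => //; rewrite mulmxA -wordmx_cat ltW.
set v' := M z1 *m v in z1t.
have ey : y = M u1 *m v' by rewrite /y ew1 wordmx_cat -mulmxA.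
pose m := t / b; have m0 : 0 < m by rewrite divr_gt0.
have u1n : u1 != [::].
  apply: contraTneq ty => e; rewrite ey e wordmx_nil mul1mx -leNgt //.
have v'm : m <= nrm v'.
  case: u1 hu1 u1n {ew1 ey} => // i u1 hu1 _.
  case/lastP: u1 hu1 => [|u1 j] hu1.
    have := hu1 [::] [:: i] erefl isT; rewrite /m ler_pdivrMr // => /ltW h.
    apply: le_trans h _; rewrite wordmx_cat -mulmxA -/v' wordmx_cons wordmx_nil mulmx1.
    by rewrite mulrC letter_le.
  have := hu1 (i :: u1) [:: j]; rewrite /= cats1 => /(_ erefl isT) /ltW h.
  rewrite /m ler_pdivrMr //; apply: le_trans h _.
  rewrite (_ : j :: z1 = [:: j] ++ z1) // wordmx_cat -mulmxA -/v' wordmx_cons wordmx_nil mulmx1.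
  by rewrite mulrC letter_le.
(* [W] runs from the last time before [y] at which the orbit is at most [t] to the first such time
   after [y]. Its two end norms lie between [m = t / b] and [t], and no norm in between is below
   [m]. *)
pose W := u2 ++ u1.
have hW p1 p2 : W = p1 ++ p2 -> m <= nrm (M p2 *m v').
  move=> e; rewrite /m ler_pdivrMr // mulrC.
  have [[r eq]|[r er eq]] := eq_cat_split e.
    have [p20|p20] := eqVneq p2 [::].
      by rewrite p20 wordmx_nil mul1mx mulrC -ler_pdivrMr.
    have := hu1 _ _ eq p20; rewrite wordmx_cat -mulmxA -/v' => /ltW h.
    by apply: le_trans h _; rewrite ler_peMl ?enorm2_ge0.
  by rewrite eq wordmx_cat -mulmxA -ey; exact: hu2 er.
have eW : M W *m v' = M u2 *m y by rewrite wordmx_cat -mulmxA -ey.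
have := triangular_bound m0 hW; rewrite eW => tri.
set p := nrm (M u2 *m y) in tri u2t *; set q := nrm v' in tri z1t v'm *.
have pm : m <= p by rewrite /p -eW; apply: (hW [::] W).
have q0 : 0 < q by exact: lt_le_trans v'm.
have p0 : 0 < p by exact: lt_le_trans pm.
have tm : t = b * m by rewrite /m mulrC divfK // gt_eqF.
have bd : frob (M W) <= 2 * (2 * b + b ^+ 3) * (1 + (size W)%:R).
  rewrite -mulrA; apply: frob_le_cols => x x1.
  apply: le_trans (tri x) _; rewrite x1 mul1r.
  have r1 : p / q <= b by rewrite ler_pdivrMr // (le_trans u2t) // tm ler_wpM2l // ltW.
  have r2 : q / p <= b by rewrite ler_pdivrMr // (le_trans z1t) // tm ler_wpM2l // ltW.
  have r3 : b * (size W)%:R * q * p / m ^+ 2 <= b ^+ 3 * (size W)%:R.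
    rewrite ler_pdivrMr ?exprn_gt0 //.
    have qp : q * p <= (b * m) * (b * m) by rewrite -tm ler_pM // ltW.
    rewrite -(mulrA (b * _)).
    apply: le_trans (ler_wpM2l (mulr_ge0 (ltW b0) (ler0n R (size W))) qp) _.
    by rewrite le_eqVlt; apply/orP; left; apply/eqP; ring.
  have : 0 <= (size W)%:R * b by rewrite mulr_ge0 // ltW.
  have : 0 <= b ^+ 3 by rewrite exprn_ge0 // ltW.
  lra.
have sW : (size W < n1)%N.
  rewrite ltnNge; apply/negP => /hn1; rewrite ltNge => /negP; apply.
  exact: le_trans (growth W) bd.
have : nrm y <= b ^+ n1 * t.
  rewrite ey; apply: le_trans (word_le _ _) _; rewrite ler_pM ?enorm2_ge0 ?exprn_ge0 ?(ltW b0) //.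
  rewrite ler_weXn2l //.
  by apply: leq_trans (ltnW sW); rewrite /W size_cat leq_addl.
have -> : b ^+ n1 * t = nrm y / 2 by rewrite /t /eps; field; rewrite gt_eqF.
lra.
Qed.

Lemma frob_word_inv w : frob (invmx (M w)) = frob (M w).
Proof.
by rewrite frob_invmx ?word_det1 ?invr1 ?mul1r // unitmxE unitfE -normr_gt0 word_det1.
Qed.

Lemma frob_word_gt0 w : 0 < frob (M w).
Proof.
by apply: lt_le_trans (growth w); rewrite mulr_gt0 // exprn_gt0 // (lt_trans ltr01 l1).
Qed.

(** Let [y] be the image of a unit vector well expanded by [w], and [s] a unit vector strongly
    contracted by [u]. After the last [n2] letters of [u], [y] is still long by [no_hump] while [s]
    is already short by [decay], so [y] is transversal to [s]. Area is preserved and [u] shrinks [s]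
    to length [1 / d], hence it stretches [y] by about [d], which is comparable to [|M u|]. *)
Lemma quasi_multiplicative_unimodular : exists2 k : R, 0 < k &
  forall u w, k * (frob (M u) * frob (M w)) <= frob (M (u ++ w)).
Proof.
have [eps e0 hump] := no_hump.
have [n2 hn2] := exp_beats_linear (2 * (3 / eps + 2 * b / eps ^+ 3)) c0 l1.
(* If [s] were still long after [w1], [no_hump] applied from each intermediate time would keep its
   whole orbit above [eps * a], and [triangular_bound] would contradict the choice of [n2]. *)
have decay w2 w1 (s : 'cV[R]_2) : size w1 = n2 -> nrm s = 1 ->
    nrm (M (w2 ++ w1) *m s) <= eps ^+ 2 / 2 -> nrm (M w1 *m s) <= eps / 2.
  move=> sw1 s1 hs; rewrite leNgt; apply/negP => ha.
  set a := nrm (M w1 *m s) in ha.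
  have a0 : 0 < a by lra.
  have m0 : 0 < eps * a by rewrite mulr_gt0.
  have hm u1 u2 : w1 = u1 ++ u2 -> eps * a <= nrm (M u2 *m s).
    move=> ew; rewrite leNgt; apply/negP => lt.
    have := hump w2 u1 (M u2 *m s); rewrite !mulmxA -!wordmx_cat -catA -ew => /(_ lt).
    rewrite leNgt => /negP; apply; apply: le_lt_trans hs _.
    by rewrite expr2 -mulrA ltr_pM2l.
  have ea : eps * a <= 1.
    by have := hm w1 [::] (esym (cats0 _)); rewrite wordmx_nil mul1mx s1.
  have := hn2 n2 (leqnn _); rewrite ltNge => /negP; apply.
  rewrite -{1}sw1; apply: le_trans (growth w1) _.
  rewrite -(mulrA 2 (_ + _)); apply: frob_le_cols => x x1.
  apply: le_trans (triangular_bound m0 hm x) _.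
  rewrite x1 s1 -/a sw1 !mul1r invr1 !mulr1.
  have i1 : a <= 1 / eps by rewrite ler_pdivlMr // mulrC.
  have i2 : a^-1 <= 2 / eps.
    by rewrite -[leRHS]invrK lef_pV2 ?posrE ?invr_gt0 ?divr_gt0 // invf_div ltW.
  have i3 : b * n2%:R * a / (eps * a) ^+ 2 <= 2 * b / eps ^+ 3 * n2%:R.
    have -> : b * n2%:R * a / (eps * a) ^+ 2 = b * n2%:R / eps ^+ 2 * a^-1.
      by field; rewrite !gt_eqF.
    have -> : 2 * b / eps ^+ 3 * n2%:R = b * n2%:R / eps ^+ 2 * (2 / eps).
      by field; rewrite gt_eqF.
    by apply: ler_wpM2l => //; rewrite divr_ge0 ?mulr_ge0 ?exprn_ge0 ?(ltW b0) ?(ltW e0).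
  have i4 : 0 <= 2 * b / eps ^+ 3 by rewrite divr_ge0 ?mulr_ge0 ?exprn_ge0 ?(ltW b0) ?(ltW e0).
  have i5 : 0 <= n2%:R * eps^-1 by rewrite mulr_ge0 // invr_ge0 ltW.
  lra.
have bn0 : 0 < b ^+ n2 by rewrite exprn_gt0.
have e20 : 0 < eps ^+ 2 by rewrite exprn_gt0.
(* One summand per use: a norm above the first forces at least [n2] letters in [u], above the second
   it makes [s] contracted enough for [decay], above the third it makes [y] long enough for
   [no_hump]. *)
pose K1 := 2 * b ^+ n2 + 4 / eps ^+ 2 + 2 / eps.
have h1 : 0 < 4 / eps ^+ 2 by rewrite divr_gt0.
have h2 : 0 < 2 / eps by rewrite divr_gt0.
have K10 : 0 < K1 by rewrite /K1; lra.
pose k := Num.min (K1 ^+ 2)^-1 (eps / (8 * b ^+ n2)).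
exists k; first by rewrite lt_min invr_gt0 exprn_gt0 //= divr_gt0 // mulr_gt0.
move=> u w; set p := frob (M u); set q := frob (M w).
have p0 : 0 < p := frob_word_gt0 u.
have q0 : 0 < q := frob_word_gt0 w.
have uM z : M z \in unitmx by rewrite unitmxE unitfE -normr_gt0 word_det1.
(* If one factor has norm at most [K1], so does its inverse, and cancelling it from the product
   loses at most [K1]. *)
have [small|large] := leP (Num.min p q) K1.
  apply: le_trans (_ : (K1 ^+ 2)^-1 * (p * q) <= _).
    by rewrite ler_pM2r ?mulr_gt0 // ge_min lexx.
  rewrite mulrC ler_pdivrMr ?exprn_gt0 //.
  have uw0 : 0 <= frob (M (u ++ w)) by exact: frob_ge0.
  move: small; rewrite ge_min => /orP[] sm.
    have : q <= p * frob (M (u ++ w)).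
      rewrite /p -(frob_word_inv u); apply: le_trans (frob_mul _ _).
      by rewrite wordmx_cat mulKmx.
    move=> /(ler_wpM2l (ltW p0)) /le_trans; apply; rewrite mulrA mulrC ler_wpM2l //.
    by rewrite expr2 ler_pM // ltW.
  have : p <= frob (M (u ++ w)) * q.
    rewrite /q -(frob_word_inv w); apply: le_trans (frob_mul _ _).
    by rewrite wordmx_cat mulmxK.
  move=> /(ler_wpM2r (ltW q0)) /le_trans; apply; rewrite -mulrA ler_wpM2l //.
  by rewrite expr2 ler_pM // ltW.
move: large; rewrite lt_min => /andP[pK qK].
apply: le_trans (_ : eps / (8 * b ^+ n2) * (p * q) <= _).
  by rewrite ler_pM2r ?mulr_gt0 // ge_min lexx orbT.
have su : (n2 <= size u)%N.
  rewrite leqNgt; apply/negP => /ltnW le.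
  have : p <= 2 * b ^+ n2.
    apply: frob_le_cols => x x1; apply: le_trans (word_le _ _) _.
    by rewrite x1 mulr1 ler_weXn2l.
  by rewrite leNgt => /negP; apply; apply: lt_trans pK; rewrite /K1; lra.
pose u1 := drop (size u - n2) u; pose u2 := take (size u - n2) u.
have eu : u = u2 ++ u1 by rewrite cat_take_drop.
have su1 : size u1 = n2 by rewrite size_drop subKn.
have [e e1 qe] := frob_attained (M w); rewrite -/q in qe.
set y := M w *m e in qe; set a := nrm y in qe.
have a0 : 0 < a by lra.
have ea : 1 < eps * a.
  have : 2 / eps < q by apply: lt_trans qK; rewrite /K1; lra.
  rewrite ltr_pdivrMr //; nra.
have hy : eps * a <= nrm (M u1 *m y).
  by rewrite /y mulmxA -wordmx_cat; apply: hump; rewrite e1.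
have [f f1 pf] := frob_attained (invmx (M u)); rewrite frob_word_inv -/p in pf.
set g := invmx (M u) *m f in pf; set d := nrm g in pf.
have d0 : 0 < d by lra.
pose s := d^-1 *: g.
have s1 : nrm s = 1 by rewrite enorm2Z gtr0_norm ?invr_gt0 // mulVf // gt_eqF.
have es : M u *m s = d^-1 *: f by rewrite -scalemxAr /g mulKVmx.
have ns : nrm (M u *m s) = d^-1 by rewrite es enorm2Z gtr0_norm ?invr_gt0 // f1 mulr1.
clearbody s.
have u1s : nrm (M u1 *m s) <= eps / 2.
  apply: (decay u2) => //; rewrite -eu ns.
  rewrite -[leRHS]invrK lef_pV2 ?posrE ?invr_gt0 ?divr_gt0 // invf_div.
  have : 4 / eps ^+ 2 < p by apply: lt_trans pK; rewrite /K1; lra.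
  lra.
have s0 : s != 0 by rewrite -enorm2_gt0 s1.
set si := wedge s y.
have lo : eps * a <= a * (eps / 2) + `|si| * b ^+ n2.
  apply: le_trans hy _; rewrite (decomp_rot y s0) s1 expr1n !divr1 mulmxDr -!scalemxAr.
  apply: le_trans (enorm2D _ _) _; rewrite !enorm2Z lerD //.
    by rewrite ler_pM ?enorm2_ge0 //; have := dot2_le y s; rewrite s1 mulr1.
  rewrite ler_wpM2l //; apply: le_trans (word_le _ _) _.
  by rewrite enorm2_rot s1 mulr1 su1.
have up : d * `|si| <= frob (M (u ++ w)).
  apply: le_trans (_ : nrm (M u *m y) <= _); last first.
    rewrite /y mulmxA -wordmx_cat; apply: le_trans (enorm2_mulmx _ _) _.
    by rewrite e1 mulr1.
  have : `|si| <= d^-1 * nrm (M u *m y).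
    rewrite -ns; apply: le_trans (wedge_le _ _).
    by rewrite wedge_mulmx normrM word_det1 mul1r.
  by rewrite mulrC ler_pdivlMr // mulrC.
apply: le_trans up.
have si1 : eps * a / (2 * b ^+ n2) <= `|si|.
  rewrite ler_pdivrMr ?mulr_gt0 //; lra.
apply: le_trans (_ : p / 2 * (eps * (q / 2) / (2 * b ^+ n2)) <= _).
  rewrite le_eqVlt; apply/orP; left; apply/eqP; field; by rewrite gt_eqF.
apply: ler_pM => //; first by lra.
- by rewrite divr_ge0 ?mulr_ge0 ?divr_ge0 ?(ltW q0) ?(ltW bn0) ?(ltW e0).
- by lra.
apply: le_trans si1; rewrite ler_pM2r ?invr_gt0 ?mulr_gt0 // ler_pM2l //; lra.
Qed.

End Unimodular.
End Words.

(** * Singular values and Gibbs weights *)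

Section SingularValues.
Variable R : realType.
Implicit Type A : 'M[R]_2.

Lemma discr_ge0 A : 0 <= frob2 A ^+ 2 - 4 * \det A ^+ 2.
Proof.
have h := det_frob A; have d0 := normr_ge0 (\det A).
have : (2 * `|\det A|) ^+ 2 <= frob2 A ^+ 2.
  by rewrite lerXn2r ?nnegrE ?mulr_ge0 ?frob2_ge0.
by rewrite exprMn real_normK ?num_real //; lra.
Qed.

Lemma discr_le A : Num.sqrt (frob2 A ^+ 2 - 4 * \det A ^+ 2) <= frob2 A.
Proof.
rewrite -(@ler_pXn2r _ 2) ?nnegrE ?sqrtr_ge0 ?frob2_ge0 // sqr_sqrtr ?discr_ge0 //.
by rewrite gerBl mulr_ge0 ?sqr_ge0.
Qed.

Lemma sv1_sqr A : sv1 A ^+ 2 = (frob2 A + Num.sqrt (frob2 A ^+ 2 - 4 * \det A ^+ 2)) / 2.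
Proof. by rewrite sqr_sqrtr // divr_ge0 ?addr_ge0 ?frob2_ge0 ?sqrtr_ge0. Qed.

Lemma sv1_ge0 A : 0 <= sv1 A. Proof. exact: sqrtr_ge0. Qed.

Lemma sv1_sv2 A : sv1 A * sv2 A = `|\det A|.
Proof.
rewrite /sv1 /sv2 -sqrtrM; last by rewrite divr_ge0 ?addr_ge0 ?frob2_ge0 ?sqrtr_ge0.
rewrite -sqrtr_sqr; congr Num.sqrt.
have h := sqr_sqrtr (discr_ge0 A).
have e (f r d : R) : r ^+ 2 = f ^+ 2 - 4 * d ^+ 2 -> (f + r) / 2 * ((f - r) / 2) = d ^+ 2.
  by move=> hr; rewrite (_ : _ * _ = (f ^+ 2 - r ^+ 2) / 4); [rewrite hr; field|field].
exact: e.
Qed.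

Lemma sv1_le_frob A : sv1 A <= frob A.
Proof.
rewrite -(@ler_pXn2r _ 2) ?nnegrE ?sv1_ge0 ?frob_ge0 // sv1_sqr frob_sqr.
by have := discr_le A; lra.
Qed.

Lemma frob_le_sv1 A : frob A <= 2 * sv1 A.
Proof.
rewrite -(@ler_pXn2r _ 2) ?nnegrE ?mulr_ge0 ?sv1_ge0 ?frob_ge0 //.
rewrite exprMn sv1_sqr frob_sqr.
by have := sqrtr_ge0 (frob2 A ^+ 2 - 4 * \det A ^+ 2); have := frob2_ge0 A; lra.
Qed.

End SingularValues.

Section QuasiMult.
Variables (R : realType) (N : nat) (A : 'I_N -> 'M[R]_2).
Implicit Types (u w : seq 'I_N).
Hypothesis unitA : forall i, A i \in unitmx.
Hypothesis domA : dominated A.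

Lemma det_letter_neq0 i : \det (A i) != 0.
Proof. by have := unitA i; rewrite unitmxE unitfE. Qed.

Lemma frob_wordmx_gt0 w : 0 < frob (wordmx A w).
Proof.
rewrite lt_def frob_ge0 andbT; apply/eqP => h.
have := det_frob (wordmx A w); rewrite -frob_sqr h expr0n /=.
have : 0 < `|\det (wordmx A w)|.
  by rewrite normr_gt0; apply: wordmx_det_neq0; exact: det_letter_neq0.
lra.
Qed.

Lemma dominated_det : exists C tau : R, [/\ 0 < C, 0 < tau < 1 &
  forall w, `|\det (wordmx A w)| <= C * tau ^+ size w * frob2 (wordmx A w)].
Proof.
have [C [tau [C0 [t01 h]]]] := domA; exists C, tau; split=> // w.
rewrite -sv1_sv2; apply: le_trans (ler_wpM2l (sv1_ge0 _) (h w)) _.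
rewrite mulrCA; apply: ler_wpM2l.
  by case/andP: t01 => t0 _; rewrite mulr_ge0 ?exprn_ge0 ?(ltW C0) ?(ltW t0).
rewrite -frob_sqr -expr2 lerXn2r ?nnegrE ?sv1_ge0 ?frob_ge0 //; exact: sv1_le_frob.
Qed.

(** Dividing each letter by the square root of [|det|] makes it unimodular, and the scaling cancels
    because it is multiplicative along words. Under this normalisation domination reads
    [1 <= C * tau ^+ n * |B_w| ^+ 2], which is exponential growth. *)
Lemma quasi_multiplicative : exists2 k : R, 0 < k &
  forall u w, k * (frob (wordmx A u) * frob (wordmx A w)) <= frob (wordmx A (u ++ w)).
Proof.
pose e i := (Num.sqrt `|\det (A i)|)^-1.
have e0 i : 0 < e i by rewrite invr_gt0 sqrtr_gt0 normr_gt0 det_letter_neq0.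
pose B i := e i *: A i.
have [t ht] : exists t : seq 'I_N -> R, forall w,
   [/\ 0 < t w, wordmx B w = t w *: wordmx A w & forall u, t (u ++ w) = t u * t w].
  exists (fun w => \prod_(i <- w) e i) => w; split.
  - by apply: prodr_gt0 => i _.
  - elim: w => [|i w ih]; first by rewrite !wordmx_nil big_nil scale1r.
    rewrite !wordmx_cons big_cons ih /B -scalemxAl -scalemxAr scalerA.
    by [].
  - by move=> u; rewrite big_cat.
have detB i : `|\det (B i)| = 1.
  rewrite /B detZ normrM ger0_norm ?exprn_ge0 ?(ltW (e0 i)) //.
  by rewrite /e exprVn sqr_sqrtr // mulVf // normr_eq0 det_letter_neq0.
pose b := 1 + \sum_i frob (B i).
have b1 : 1 <= b by rewrite lerDl sumr_ge0 // => i _; exact: frob_ge0.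
have frobB i : frob (B i) <= b.
  rewrite /b (bigD1 i) //= addrCA lerDl addr_ge0 ?sumr_ge0 // => j _; exact: frob_ge0.
have [C [tau [C0 /andP[tau0 tau1] dom]]] := dominated_det.
have growth w : Num.sqrt C^-1 * Num.sqrt tau^-1 ^+ size w <= frob (wordmx B w).
  rewrite -(@ler_pXn2r _ 2) ?nnegrE ?frob_ge0 ?mulr_ge0 ?exprn_ge0 ?sqrtr_ge0 //.
  rewrite frob_sqr exprMn -exprM mulnC exprM !sqr_sqrtr ?invr_ge0 ?(ltW C0) ?(ltW tau0) //.
  have d1 := word_det1 detB w; have [t0 ew _] := ht w.
  have := dom w; have -> : frob2 (wordmx B w) = t w ^+ 2 * frob2 (wordmx A w).
    by rewrite ew -!frob_sqr frobZ exprMn real_normK ?num_real.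
  move: d1; rewrite ew detZ normrM ger0_norm ?exprn_ge0 ?(ltW t0) // => d1.
  move=> /(ler_wpM2l (exprn_ge0 2 (ltW t0))); rewrite d1 => h.
  rewrite exprVn -invfM -[leLHS]mul1r ler_pdivrMr ?mulr_gt0 ?exprn_gt0 //.
  by apply: le_trans h _; rewrite le_eqVlt; apply/orP; left; apply/eqP; ring.
have c0 : 0 < Num.sqrt C^-1 by rewrite sqrtr_gt0 invr_gt0.
have l1 : 1 < Num.sqrt tau^-1.
  by rewrite -sqrtr1 ltr_sqrt ?invr_gt0 // invf_gt1.
have [k k0 hk] := quasi_multiplicative_unimodular b1 detB frobB c0 l1 growth.
exists k => // u w; have := hk u w.
have [tu eu _] := ht u; have [tw ew tM] := ht w; have [tuw euw _] := ht (u ++ w).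
rewrite eu ew euw !frobZ !gtr0_norm // tM.
rewrite (_ : k * _ = t u * t w * (k * (frob (wordmx A u) * frob (wordmx A w)))); last by ring.
by rewrite ler_pM2l ?mulr_gt0.
Qed.

End QuasiMult.

(** * Weights of the continuations of a word and zero pressure *)

Section TailSums.
Variables (R : realType) (N : nat).
Implicit Types (b : seq 'I_N -> R) (u w : seq 'I_N).

(** Total weight of the [n]-letter continuations of [u], playing the role of the mass of the
    cylinder of [u]. Letters are appended on the right, so splitting into children is a computation
    step. *)
Fixpoint tail_sum b n u : R :=
  if n is n'.+1 then \sum_(a < N) tail_sum b n' (rcons u a) else b u.

Lemma tail_sum_tuple b n u :
  \sum_(w : n.-tuple 'I_N) b (u ++ w) = tail_sum b n u.
Proof.
elim: n u => [|n ih] u.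
  by rewrite (big_pred1 [tuple]) ?cats0 // => w; apply/esym/eqP; exact: tuple0.
have bij : {on predT, bijective (fun p : 'I_N * n.-tuple 'I_N => [tuple of p.1 :: p.2])}.
  apply: onW_bij; exists (fun w : n.+1.-tuple 'I_N => (thead w, [tuple of behead w])).
    by case=> a w /=; congr pair; apply/val_inj.
  by move=> w /=; rewrite [RHS]tuple_eta.
rewrite (reindex _ bij) /= -(pair_bigA _ (fun a (w : n.-tuple 'I_N) => b (u ++ a :: w))) /=.
apply: eq_bigr => a _; rewrite -ih; apply: eq_bigr => w _.
by rewrite cat_rcons.
Qed.

Lemma tail_sum_le b b' (K : R) n u : (forall w, b w <= K * b' w) ->
  tail_sum b n u <= K * tail_sum b' n u.
Proof.
move=> h; elim: n u => [|n ih] u //=.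
by rewrite mulr_sumr; apply: ler_sum.
Qed.

Section Gibbs.
Variables (b : seq 'I_N -> R) (k : R).
Hypotheses (N0 : (0 < N)%N) (k0 : 0 < k) (b_gt0 : forall w, 0 < b w).
Hypothesis bM : forall u w, b (u ++ w) <= b u * b w.
Hypothesis bqM : forall u w, k * (b u * b w) <= b (u ++ w).

Local Notation Z n := (tail_sum b n [::]).

Lemma tail_sum_gt0 n u : 0 < tail_sum b n u.
Proof.
elim: n u => [|n ih] u //=.
rewrite (bigD1 (Ordinal N0)) //= ltr_pwDl // sumr_ge0 // => i _; exact: ltW.
Qed.

Lemma tail_sum_cat_le n u w : tail_sum b n (u ++ w) <= b u * tail_sum b n w.
Proof.
elim: n w => [|n ih] w //=.
by rewrite mulr_sumr; apply: ler_sum => i _; rewrite rcons_cat.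
Qed.

Lemma tail_sum_cat_ge n u w : k * (b u * tail_sum b n w) <= tail_sum b n (u ++ w).
Proof.
elim: n w => [|n ih] w //=.
by rewrite mulr_sumr mulr_sumr; apply: ler_sum => i _; rewrite rcons_cat.
Qed.

Lemma tail_sumD_le n m u : tail_sum b (n + m) u <= tail_sum b n u * Z m.
Proof.
elim: n u => [|n ih] u /=.
  by have := tail_sum_cat_le m u [::]; rewrite cats0.
by rewrite mulr_suml; apply: ler_sum.
Qed.

Lemma tail_sumD_ge n m u : k * (tail_sum b n u * Z m) <= tail_sum b (n + m) u.
Proof.
elim: n u => [|n ih] u /=.
  by have := tail_sum_cat_ge m u [::]; rewrite cats0.
by rewrite mulr_suml mulr_sumr; apply: ler_sum.
Qed.

(** Along the multiples of [n] the function [f] is sublinear, which excludes a lower bound of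
    positive slope. *)
Lemma sublinear_le0 (f : nat -> R) (n : nat) (a c : R) : (0 < n)%N ->
  (fun n : nat => n%:R^-1 * f n) @ \oo --> (0 : R) ->
  (forall j, j%:R * a - c <= `|f (n * j)%N|) -> a <= 0.
Proof.
move=> n0 hf h; rewrite leNgt; apply/negP => a0.
have n0' : 0 < n%:R :> R by rewrite ltr0n.
have e0 : 0 < a / (2 * n%:R) by rewrite divr_gt0 ?mulr_gt0.
have [m _ hm] := (@cvgrPdist_lt _ _ _ _ _ _ _).1 hf _ e0.
pose j := (m + (Num.truncn (2 * c / a)).+1)%N.
have j0 : (0 < j)%N by rewrite /j addnS.
have jc : 2 * c / a < j%:R.
  by apply: lt_le_trans (truncnS_gt _) _; rewrite ler_nat leq_addl.
have := hm (n * j)%N; rewrite /= sub0r normrN normrM.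
have nj0 : 0 < (n * j)%:R :> R by rewrite ltr0n muln_gt0 n0.
have -> : (m <= n * j)%N.
  by apply: leq_trans (leq_pmull _ n0); rewrite leq_addr.
move=> /(_ isT); rewrite gtr0_norm ?invr_gt0 // mulrC ltr_pdivrMr // => h1.
have := le_lt_trans (h j) h1.
rewrite natrM (_ : a / _ * _ = a * j%:R / 2); last by field; rewrite gt_eqF.
by move: jc; rewrite ltr_pdivrMr //; lra.
Qed.

(** [Z] is submultiplicative, and supermultiplicative up to [k]. If [Z n < 1] or [k * Z n > 1] for
    one [n > 0], the powers along the multiples of [n] would decay or grow exponentially, against
    the zero growth rate. The case [n = 0] is read off from one block of length 1. *)
Lemma partition_bounds (p : nat -> R) : (forall n, 0 < p n) ->
  (forall n, p n <= Z n) -> (forall n, Z n <= 2 * p n) ->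
  (fun n : nat => n%:R^-1 * ln (p n)) @ \oo --> (0 : R) ->
  forall n, 1 <= Z n /\ k * Z n <= 1.
Proof.
move=> p0 pZ Zp hp.
have Z0 n : 0 < Z n := tail_sum_gt0 n [::].
case=> [|n].
  have := tail_sumD_le 0 1 [::]; have := tail_sumD_ge 0 1 [::]; rewrite add0n => h1 h2.
  split; first by move: h2; rewrite -[leLHS]mul1r ler_pM2r.
  by move: h1; rewrite mulrA -[leRHS]mul1r ler_pM2r.
have pos : (0 < n.+1)%N by [].
have up j : Z (n.+1 * j)%N <= Z 0 * Z n.+1 ^+ j.
  elim: j => [|j ih]; first by rewrite muln0 mulr1.
  rewrite mulnS exprS; apply: le_trans (tail_sumD_le _ _ _) _.
  by rewrite mulrCA ler_pM2l.
have lo j : Z 0 * (k * Z n.+1) ^+ j <= Z (n.+1 * j)%N.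
  elim: j => [|j ih]; first by rewrite muln0 mulr1.
  rewrite mulnS exprS; apply: le_trans (tail_sumD_ge _ _ _).
  by rewrite mulrCA -mulrA ler_pM2l // ler_pM2l.
have kZ0 : 0 < k * Z n.+1 by rewrite mulr_gt0.
split.
  have : - ln (Z n.+1) <= 0.
    apply: (sublinear_le0 (c := ln (Z 0)) pos hp) => j.
    have : ln (p (n.+1 * j)%N) <= ln (Z 0) + ln (Z n.+1) *+ j.
      rewrite -lnXn // -lnM ?posrE ?exprn_gt0 // ler_ln ?posrE ?mulr_gt0 ?exprn_gt0 //.
      exact: le_trans (pZ _) (up j).
    by have := ler_norm (- ln (p (n.+1 * j)%N)); rewrite normrN -mulr_natl; lra.
  rewrite oppr_le0 => h; rewrite leNgt; apply/negP => Z1.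
  by move: h; rewrite leNgt ln_lt0 // Z0 Z1.
have : ln (k * Z n.+1) <= 0.
  apply: (sublinear_le0 (c := ln 2 - ln (Z 0)) pos hp) => j.
  have : ln (Z 0) + ln (k * Z n.+1) *+ j <= ln 2 + ln (p (n.+1 * j)%N).
    rewrite -lnXn // -!lnM ?posrE ?exprn_gt0 // ler_ln ?posrE ?mulr_gt0 ?exprn_gt0 //.
    exact: le_trans (lo j) (Zp _).
  by have := ler_norm (ln (p (n.+1 * j)%N)); rewrite -mulr_natl; lra.
by move=> h; rewrite leNgt; apply/negP => /ln_gt0; rewrite ltNge h.
Qed.

End Gibbs.
End TailSums.

(** * Finite covers and strips *)

Section Covers.
Variables (R : realType) (s : R).
Hypotheses (s0 : 0 < s).
Local Notation nrm := (@enorm2 R).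
Implicit Types (X Y U : set 'cV[R]_2).

(** Real bounds [d i] replace the extended diameters, so that costs can be scaled and added in [R];
    finiteness allows gluing along finite sets of words. *)
Definition fin_cover Y (delta t : R) : Prop :=
  exists (I : finType) (U : I -> set 'cV[R]_2) (d : I -> R),
  [/\ forall y, Y y -> exists i, U i y,
      forall i x y, U i x -> U i y -> nrm (x - y) <= d i,
      forall i, 0 <= d i <= delta &
      \sum_i d i `^ s <= t].

Lemma fin_cover_set0 (delta : R) : fin_cover set0 delta 0.
Proof.
by exists void, (fun=> set0), (fun=> 0); split=> //; rewrite big_pred0 //; case.
Qed.

Lemma fin_coverU Y1 Y2 (delta t1 t2 : R) : fin_cover Y1 delta t1 ->
  fin_cover Y2 delta t2 -> fin_cover (Y1 `|` Y2) delta (t1 + t2).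
Proof.
move=> [I1 [U1 [d1 [c1 m1 b1 h1]]]] [I2 [U2 [d2 [c2 m2 b2 h2]]]].
exists (I1 + I2)%type, (fun i => match i with inl j => U1 j | inr j => U2 j end),
  (fun i => match i with inl j => d1 j | inr j => d2 j end); split.
- by move=> y [/c1[i]|/c2[i]] h; [exists (inl i)|exists (inr i)].
- by case=> i; [apply: m1|apply: m2].
- by case.
- by rewrite big_sumType lerD.
Qed.

Lemma fin_cover_bigcup (J : finType) (Y : J -> set 'cV[R]_2) (delta : R) (t : J -> R) :
  (forall j, fin_cover (Y j) delta (t j)) ->
  fin_cover (\bigcup_j Y j) delta (\sum_j t j).
Proof.
move=> h; have -> : \bigcup_j Y j = [set y | exists2 j, j \in enum J & Y j y].
  apply/seteqP; split=> y [j _ yj]; exists j => //; exact: mem_enum.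
rewrite -big_enum /=; elim: (enum J) => [|j l ih].
  rewrite big_nil (_ : [set _ | _] = set0); first exact: fin_cover_set0.
  by apply/seteqP; split=> y // [].
rewrite big_cons (_ : [set _ | _] = Y j `|` [set y | exists2 j, j \in l & Y j y]).
  exact: fin_coverU.
apply/seteqP; split=> y.
  by move=> [k]; rewrite inE => /orP[/eqP ->|kl] yk; [left|right; exists k].
move=> [yj|[k kl yk]]; first by exists j => //; exact: mem_head.
by exists k => //; rewrite inE kl orbT.
Qed.

Lemma fin_cover_le Y Y' (delta delta' t t' : R) : Y' `<=` Y -> delta <= delta' -> t <= t' ->
  fin_cover Y delta t -> fin_cover Y' delta' t'.
Proof.
move=> sY dd tt [I [U [d [c m b h]]]]; exists I, U, d; split=> //.
- by move=> y /sY /c.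
- by move=> i; have /andP[-> /le_trans ->] := b i.
- exact: le_trans tt.
Qed.

Lemma diam_le U (d : R) : 0 <= d -> (forall x y, U x -> U y -> nrm (x - y) <= d) ->
  (diam U <= d%:E)%E.
Proof.
move=> d0 h; apply: ge_ereal_sup => r [->|[x [y [Ux [Uy ->]]]]].
  by rewrite lee_fin.
by rewrite lee_fin h.
Qed.

Lemma diam_ge0 U : (0 <= diam U)%E.
Proof. by apply: ereal_sup_ubound; left. Qed.

Lemma diam_ge U x y : U x -> U y -> ((nrm (x - y))%:E <= diam U)%E.
Proof. by move=> Ux Uy; apply: ereal_sup_ubound; right; exists x, y. Qed.

Lemma diam0 : diam (set0 : set 'cV[R]_2) = 0%E.
Proof. by apply/eqP; rewrite eq_le diam_ge0 andbT; apply: diam_le. Qed.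

Lemma fin_cover_Hdelta Y (delta t : R) : 0 <= delta -> fin_cover Y delta t ->
  (Hdelta s delta Y <= t%:E)%E.
Proof.
move=> delta0 [I [U [d [c m b h]]]].
(* The sequence is padded with empty sets, whose cost is 0 because [s > 0]. *)
pose V n := nth set0 [seq U i | i <- enum I] n.
have VE n (i0 : I) : (n < size (enum I))%N -> V n = U (nth i0 (enum I) n).
  by move=> hn; rewrite /V (nth_map i0).
have V0 n : (size (enum I) <= n)%N -> V n = set0.
  by move=> hn; rewrite /V nth_default // size_map.
apply: ge_ereal_inf; exists (\sum_(0 <= i <oo) poweR (diam (V i)) s)%E.
  exists V; split; last split => //.
    move=> y /c[i Ui]; exists (index i (enum I)) => //.
    by rewrite (VE _ i) ?index_mem ?mem_enum // nth_index // mem_enum.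
  move=> n; have [hn|hn] := ltnP n (size (enum I)); last by rewrite V0 // diam0 lee_fin.
  have i0 : I by case: (enum I) hn.
  rewrite (VE _ i0) //; set i := nth _ _ _; have /andP[d0 dd] := b i.
  by apply: le_trans (diam_le d0 (m i)) _; rewrite lee_fin.
rewrite (@nneseries_split _ _ 0 (size (enum I))); last by move=> k _; exact: poweR_ge0.
rewrite [X in (_ + X)%E]eseries0 ?adde0; last first.
  by move=> i hi _; rewrite V0 // diam0 poweR0r // gt_eqF.
rewrite add0n; apply: le_trans (_ : (\sum_i d i `^ s)%:E <= _)%E; last by rewrite lee_fin.
rewrite -big_enum /=; case: (enum I) V V0 VE => [|i0 l] V V0 VE.
  by rewrite big_geq // big_nil.
rewrite (big_nth i0) -sumEFin !big_mkord; apply: lee_sum => n _.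
rewrite (VE _ i0) //; set i := nth _ _ _; have /andP[d0 dd] := b i.
rewrite -poweR_EFin; apply: gt0_ler_poweR; first exact: ltW.
- by rewrite in_itv /= diam_ge0 leey.
- by rewrite in_itv /= lee_fin d0 leey.
exact: diam_le (m i).
Qed.

Lemma fin_cover_Hcontent Y (delta t : R) : 0 <= delta -> fin_cover Y delta t ->
  (Hcontent s Y <= t%:E)%E.
Proof.
move=> d0 /(fin_cover_Hdelta d0); apply: le_trans.
by apply: ereal_inf_le_tmp => h [U [cU [_ ->]]]; exists U.
Qed.

(** The reciprocal of a sum of reciprocals serves as the bound; the summand 1 takes care of an empty
    [I]. *)
Lemma common_lower_bound (I : finType) (f : I -> R) : (forall i, 0 < f i) ->
  exists2 r : R, 0 < r & forall i, r <= f i.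
Proof.
move=> f0; have S0 : 0 <= \sum_i (f i)^-1 by rewrite sumr_ge0 // => i _; rewrite invr_ge0 ltW.
exists (1 + \sum_i (f i)^-1)^-1; first by rewrite invr_gt0; lra.
move=> i; rewrite -[leRHS]invrK lef_pV2 ?posrE ?invr_gt0 //; last by lra.
rewrite (bigD1 i) //= addrCA lerDl addr_ge0 // sumr_ge0 // => j _.
by rewrite invr_ge0 ltW.
Qed.

Lemma near_enorm2 (x : 'cV[R]_2) (e : R) : 0 < e -> \forall y \near x, nrm (y - x) < e.
Proof.
move=> e0; have e2 : 0 < e / 2 by rewrite divr_gt0.
apply/nbhs_ballP; exists (e / 2) => //= y [_ h].
have hc i : `|(y - x) i 0| < e / 2.
  by rewrite !mxE distrC; have := h i 0.
by apply: le_lt_trans (enorm2_coord_le _) _; have := hc 0; have := hc 1; lra.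
Qed.

Lemma frob_coord_le (M : 'M[R]_2) (e : R) : (forall i j, `|M i j| <= e) -> frob M <= 2 * e.
Proof.
move=> h; have e0 : 0 <= e := le_trans (normr_ge0 _) (h 0 0).
rewrite -(@ler_pXn2r _ 2) ?nnegrE ?mulr_ge0 ?frob_ge0 // frob_sqr frob2E.
have h2 i j : M i j ^+ 2 <= e ^+ 2.
  by rewrite -[leLHS]real_normK ?num_real // lerXn2r ?nnegrE.
by have := h2 0 0; have := h2 0 1; have := h2 1 0; have := h2 1 1; rewrite exprMn; lra.
Qed.

Lemma near_frob (M : 'M[R]_2) (e : R) : 0 < e -> \forall M' \near M, frob (M' - M) < e.
Proof.
move=> e0; have e2 : 0 < e / 4 by rewrite divr_gt0.
apply/nbhs_ballP; exists (e / 4) => //= M' [_ h].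
apply: le_lt_trans (_ : 2 * (e / 4) < e); last by lra.
apply: frob_coord_le => i j; rewrite !mxE distrC ltW //.
by have := h i j.
Qed.

(** * Strip covers of a compact set *)

Section Strips.
Variables (X : set 'cV[R]_2).
Hypotheses (s1 : s <= 1) (cX : compact X).

Lemma compact_enorm2_bounded : exists2 R0 : R, 0 < R0 & forall x, X x -> nrm x <= R0.
Proof.
have [M [_ hM]] := compact_bounded cX.
exists (2 * (`|M| + 1)); first by rewrite mulr_gt0 // ltr_wpDl.
move=> x Xx; apply: le_trans (enorm2_coord_le x) _.
have := hM (`|M| + 1) _ x Xx; rewrite (le_lt_trans (ler_norm M)) ?ltrDl // => /(_ isT) h.
have hc i : `|x i 0| <= `|M| + 1.
  apply: le_trans h; rewrite [leRHS]/Num.norm /= mx_normE -[leLHS]nngE num_le.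
  exact: (le_bigmax _ (fun ij : 'I_2 * 'I_1 => `|x ij.1 ij.2|%:nng) (i, 0)).
by have := hc 0; have := hc 1; lra.
Qed.

(** The strips are the level sets of [dot2 n] over the sets [J i]. Positive widths and a strict
    bound on the cost leave room for a relative thickening. *)
Definition strip_cover (n : 'cV[R]_2) (eta : R) : Prop :=
  exists (I : finType) (J : I -> set R) (d : I -> R),
  [/\ forall x, X x -> exists i, J i (dot2 n x),
      forall i t u, J i t -> J i u -> `|t - u| <= d i,
      forall i, 0 < d i &
      \sum_i d i `^ s < eta].

(** Since [s <= 1], widening by [1 + th] multiplies the cost by at most [1 + th]. *)
Lemma strip_slack (I : finType) (d : I -> R) (eta : R) : \sum_i d i `^ s < eta ->
  (forall i, 0 < d i) ->
  exists2 th : R, 0 < th & \sum_i ((1 + th) * d i) `^ s < eta.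
Proof.
set S := \sum_i _ => Se d0.
have S0 : 0 <= S by rewrite sumr_ge0 // => i _; exact: powR_ge0.
pose th := (eta - S) / (S + 1).
have th0 : 0 < th by rewrite divr_gt0 //; lra.
exists th => //; apply: le_lt_trans (_ : (1 + th) * S < eta).
  rewrite mulr_sumr; apply: ler_sum => i _; rewrite powRM ?(ltW (d0 i)) //; last by lra.
  by rewrite ler_wpM2r ?powR_ge0 // ler1_powR //; lra.
have : th * S < eta - S.
  rewrite /th mulrAC ltr_pdivrMr; last by lra.
  rewrite ltr_pM2l; lra.
lra.
Qed.

(** Moving [n] by [r] moves [dot2 n x] by at most [r * R0] on [X]; the [r] chosen keeps twice this
    below the slack [th * d i]. *)
Lemma strip_cover_near (n : 'cV[R]_2) (eta : R) : strip_cover n eta ->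
  exists2 r : R, 0 < r & forall n', nrm (n' - n) <= r -> strip_cover n' eta.
Proof.
move=> [I [J [d [c m d0 h]]]]; have [th th0 hth] := strip_slack h d0.
have [R0 R00 hR0] := compact_enorm2_bounded.
have [r r0 hr] := common_lower_bound (f := fun i => th * d i / (2 * R0))
  (fun i => divr_gt0 (mulr_gt0 th0 (d0 i)) (mulr_gt0 (ltr0n _ 2) R00)).
exists r => // n' hn'.
exists I, (fun i => [set t | exists2 u, J i u & `|t - u| <= r * R0]),
   (fun i => (1 + th) * d i); split=> //.
- move=> x Xx; have [i Ji] := c x Xx; exists i; exists (dot2 n x) => //.
  rewrite (_ : _ - _ = dot2 (n' - n) x); last by rewrite !dot2E !mxE; ring.
  apply: le_trans (dot2_le _ _) _; apply: ler_pM; rewrite ?enorm2_ge0 //; exact: hR0.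
- move=> i t u [t' Jt' tt'] [u' Ju' uu'].
  have := m i _ _ Jt' Ju'; have := hr i; rewrite ler_pdivlMr ?mulr_gt0 //.
  move: tt' uu'; rewrite !ler_norml => /andP[? ?] /andP[? ?] ? /andP[? ?].
  by apply/andP; split; lra.
- by move=> i; rewrite mulr_gt0 //; lra.
Qed.

(** A strip piece is thin along [n] and has length up to [2 * R0] along [rot n]. The second
    direction is contracted so strongly that its image fits into the slack, so one set of size about
    [frob M * d i] covers the image of the whole piece. [K] is a common bound for the widths. *)
Lemma strip_cover_image (n : 'cV[R]_2) (eta : R) : nrm n = 1 -> strip_cover n eta ->
  exists r K : R, [/\ 0 < r, 0 < K & forall (M : 'M[R]_2) (f : 'cV[R]_2 -> 'cV[R]_2),
    (forall x y, f x - f y = M *m (x - y)) -> nrm (M *m rot n) <= r * frob M ->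
    fin_cover (f @` X) (frob M * K) (frob M `^ s * eta)].
Proof.
move=> n1 [I [J [d [c m d0 h]]]]; have [th th0 hth] := strip_slack h d0.
have [R0 R00 hR0] := compact_enorm2_bounded.
have [r r0 hr] := common_lower_bound (f := fun i => th * d i / (2 * R0))
  (fun i => divr_gt0 (mulr_gt0 th0 (d0 i)) (mulr_gt0 (ltr0n _ 2) R00)).
have S0 : 0 <= \sum_i (1 + th) * d i.
  by rewrite sumr_ge0 // => i _; rewrite mulr_ge0 ?(ltW (d0 i)) //; lra.
exists r, (1 + \sum_i (1 + th) * d i); split=> //; first by lra.
move=> M f fM hM.
exists I, (fun i => [set y | exists x, [/\ X x, J i (dot2 n x) & y = f x]]),
   (fun i => frob M * ((1 + th) * d i)); split=> //.
- by move=> _ [x Xx <-]; have [i Ji] := c x Xx; exists i, x.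
- move=> i _ _ [x [Xx Jx ->]] [y [Xy Jy ->]].
  have n0 : n != 0 by rewrite -enorm2_gt0 n1.
  rewrite fM (decomp_rot (x - y) n0) n1 expr1n !divr1 mulmxDr -!scalemxAr.
  apply: le_trans (enorm2D _ _) _; rewrite !enorm2Z.
  have dx : `|dot2 (x - y) n| <= d i.
    rewrite (_ : dot2 _ _ = dot2 n x - dot2 n y); first exact: m.
    by rewrite !dot2E !mxE; ring.
  have wx : `|wedge n (x - y)| <= 2 * R0.
    apply: le_trans (wedge_le _ _) _; rewrite n1 mul1r.
    apply: le_trans (enorm2D _ _) _; rewrite enorm2N.
    by have := hR0 _ Xx; have := hR0 _ Xy; lra.
  have Mn : nrm (M *m n) <= frob M by have := enorm2_mulmx M n; rewrite n1 mulr1.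
  have e1 := ler_pM (normr_ge0 _) (enorm2_ge0 _) dx Mn.
  have e2 := ler_pM (normr_ge0 _) (enorm2_ge0 _) wx hM.
  have := hr i; rewrite ler_pdivlMr ?mulr_gt0 // => /(ler_wpM2l (frob_ge0 M)).
  lra.
- move=> i; rewrite !mulr_ge0 ?frob_ge0 ?(ltW (d0 i)) //=; last by lra.
  apply: ler_wpM2l; first exact: frob_ge0.
  rewrite (bigD1 i) //= addrCA lerDl addr_ge0 // sumr_ge0 // => j _.
  by rewrite mulr_ge0 ?(ltW (d0 j)) //; lra.
rewrite (eq_bigr (fun i => frob M `^ s * ((1 + th) * d i) `^ s)).
  by rewrite -mulr_sumr; apply: ler_wpM2l; [exact: powR_ge0|exact: ltW].
move=> i _; rewrite powRM ?frob_ge0 // mulr_ge0 ?(ltW (d0 i)) //; lra.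
Qed.

Lemma fin_cover_image : exists2 D : R, 0 < D &
  forall (M : 'M[R]_2) (f : 'cV[R]_2 -> 'cV[R]_2),
    (forall x y, f x - f y = M *m (x - y)) ->
    fin_cover (f @` X) (frob M * D) (frob M `^ s * D `^ s).
Proof.
have [R0 R00 hR0] := compact_enorm2_bounded.
exists (2 * R0); first by rewrite mulr_gt0.
move=> M f fM; have D0 : 0 <= 2 * R0 by lra.
exists unit, (fun=> f @` X), (fun=> frob M * (2 * R0)); split.
- by move=> y hy; exists tt.
- move=> _ _ _ [x Xx <-] [y Xy <-]; rewrite fM; apply: le_trans (enorm2_mulmx _ _) _.
  apply: ler_wpM2l; first exact: frob_ge0.
  apply: le_trans (enorm2D _ _) _; rewrite enorm2N.
  by have := hR0 _ Xx; have := hR0 _ Xy; lra.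
- by move=> _; rewrite lexx mulr_ge0 // frob_ge0.
by rewrite big_const card_unit /= addr0 powRM ?frob_ge0.
Qed.

Definition lineproj (n : 'cV[R]_2) : set 'cV[R]_2 := [set dot2 n x *: n | x in X].

Lemma Hcontent_lt_of_strips (n : 'cV[R]_2) (eta : R) : nrm n = 1 -> strip_cover n eta ->
  (Hcontent s (lineproj n) < eta%:E)%E.
Proof.
move=> n1 [I [J [d [c m d0 h]]]].
apply: le_lt_trans (_ : (\sum_i d i `^ s)%:E < _)%E; last by rewrite lte_fin.
apply: (@fin_cover_Hcontent _ (\sum_i d i)).
  by rewrite sumr_ge0 // => i _; exact: ltW.
exists I, (fun i => [set y | exists2 t, J i t & y = t *: n]), d; split=> //.
- by move=> _ [x Xx <-]; have [i Ji] := c x Xx; exists i; exists (dot2 n x).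
- by move=> i _ _ [t Jt ->] [u Ju ->]; rewrite -scalerBl enorm2Z n1 mulr1; exact: m.
move=> i; rewrite (ltW (d0 i)) /= (bigD1 i) //= lerDl sumr_ge0 // => j _; exact: ltW.
Qed.

(* The covering sets are thickened by amounts summing to less than the slack, and
   compactness of [X] then leaves finitely many of them. *)
Lemma strips_of_Hcontent_lt (n : 'cV[R]_2) (eta : R) : nrm n = 1 ->
  (Hcontent s (lineproj n) < eta%:E)%E -> strip_cover n eta.
Proof.
move=> n1 /ereal_inf_lt[_ [U [cU ->]]].
set S := (\sum_(0 <= i <oo) _)%E => Seta.
have part k : (\sum_(0 <= i < k) (diam (U i) `^ s) <= S)%E.
  by apply: nneseries_lim_ge => i _ _; exact: poweR_ge0.
have S0 : (0 <= S)%E by apply: nneseries_ge0 => i _ _; exact: poweR_ge0.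
have Sfin : S \is a fin_num by rewrite ge0_fin_numE // (lt_trans Seta) ?ltry.
have dfin i : diam (U i) \is a fin_num.
  rewrite ge0_fin_numE ?diam_ge0 //; apply: (@lty_poweRy _ _ s); first by rewrite gt_eqF.
  apply: le_lt_trans (_ : (S < +oo)%E); last by rewrite (lt_trans Seta) ?ltry.
  apply: le_trans (part i.+1); rewrite big_nat_recr //= leeDr //.
  by apply: sume_ge0 => j _; exact: poweR_ge0.
pose d i := fine (diam (U i)).
have dE i : diam (U i) = (d i)%:E by rewrite fineK.
have d0 i : 0 <= d i by rewrite -lee_fin -dE diam_ge0.
have partd k : \sum_(i < k) d i `^ s <= fine S.
  rewrite -lee_fin fineK // -sumEFin; apply: le_trans (part k).
  by rewrite big_mkord; apply: lee_sum => i _; rewrite dE poweR_EFin.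
have Seta' : fine S < eta by rewrite -lte_fin fineK.
pose ep := (eta - fine S) / 2; have ep0 : 0 < ep by rewrite divr_gt0 // subr_gt0.
pose g i := ep / 2 ^+ i.+1.
have g0 i : 0 < g i by rewrite divr_gt0 // exprn_gt0.
have sg k : \sum_(i < k) g i <= ep.
  suff -> : \sum_(i < k) g i = ep - ep / 2 ^+ k.
    by rewrite gerBl divr_ge0 ?exprn_ge0 ?(ltW ep0).
  elim: k => [|k ih]; first by rewrite big_ord0 expr0 divr1 subrr.
  by rewrite big_ord_recr /= ih /g exprS; field; rewrite expf_neq0 ?pnatr_eq0.
(* The new width is defined through its [s]-th power: the extra cost is exactly [g i], and the width
   is positive even where [d i = 0]. *)
pose e i := (d i `^ s + g i) `^ s^-1.
have es i : e i `^ s = d i `^ s + g i.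
  by rewrite -powRrM mulVf ?gt_eqF // powRr1 // addr_ge0 ?powR_ge0 // ltW.
have e0 i : 0 < e i by rewrite powR_gt0 // ltr_wpDl // powR_ge0.
have de i : d i < e i.
  rewrite ltNge; apply/negP => le.
  have := ge0_ler_powR (ltW s0) (ltW (e0 i)) (d0 i) le.
  by rewrite es gerDl leNgt g0.
pose J i := [set t | exists2 u, U i (u *: n) & `|t - u| < (e i - d i) / 2].
have [k hk] : exists k : nat, forall x, X x -> exists2 i, (i < k)%N & J i (dot2 n x).
  (* The near-covering form of compactness along [\oo]: each point is caught, with a neighbourhood,
     by the first [k] open strips for all large [k], hence one [k] serves all of [X]. *)
  have := (compact_near_coveringP X).1 cX nat \oo
    (fun k x => exists2 i, (i < k)%N & J i (dot2 n x)) _ _.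
  case=> [x Xx|k _ hk]; last by exists k => x; exact: (hk k (leqnn k)).
  have [i _ Ui] := cU (dot2 n x *: n) (imageP _ Xx).
  have r0 : 0 < (e i - d i) / 2 by rewrite divr_gt0 // subr_gt0.
  exists ([set y | nrm (y - x) < (e i - d i) / 2], [set m | (i < m)%N]) => /=.
    by split; [exact: near_enorm2|exists i.+1].
  move=> [y m] /= [hy im]; exists i => //; exists (dot2 n x) => //.
  apply: le_lt_trans hy; rewrite (_ : _ - _ = dot2 n (y - x)).
    by apply: le_trans (dot2_le _ _) _; rewrite n1 mul1r.
  by rewrite !dot2E !mxE; ring.
exists 'I_k, (fun i : 'I_k => J i), (fun i : 'I_k => e i); split=> //.
- by move=> x /hk[i ik Ji]; exists (Ordinal ik).
- move=> i t u [t' Ut tt'] [u' Uu uu'].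
  have : `|t' - u'| <= d i.
    rewrite -lee_fin -dE; apply: le_trans (diam_ge Ut Uu).
    by rewrite -scalerBl enorm2Z n1 mulr1.
  move: tt' uu'; rewrite !ltr_norml !ler_norml => /andP[? ?] /andP[? ?] /andP[? ?].
  by apply/andP; split; lra.
rewrite (eq_bigr (fun i : 'I_k => d i `^ s + g i)) => [|i _]; last exact: es.
rewrite big_split /=; have := partd k; have := sg k; rewrite /ep; lra.
Qed.

End Strips.
End Covers.

(** * Furstenberg directions *)

Section Directions.
Variable R : realType.
Local Notation nrm := (@enorm2 R).
Implicit Types (M : 'M[R]_2) (x q : 'cV[R]_2).

Lemma rank1_det M : (\rank M = 1)%N <-> (M != 0 /\ \det M = 0).
Proof.
have full : (M \in unitmx) = (\rank M == 2)%N by rewrite -row_full_unit.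
split=> [r1|[M0 d0]].
  split; first by apply/eqP => M0; move: r1; rewrite M0 mxrank0.
  by apply/eqP; move: full; rewrite unitmxE unitfE r1 /= => /negbFE.
have := rank_leq_row M; rewrite leq_eqVlt ltnS -full unitmxE unitfE d0 eqxx /=.
rewrite leq_eqVlt ltnS leqn0 mxrank_eq0 (negbTE M0) orbF => /eqP //.
Qed.

Definition normal_dir q : 'cV[R]_2 := (nrm q)^-1 *: rot q.

Lemma normal_dir_norm q : q != 0 -> nrm (normal_dir q) = 1.
Proof.
move=> q0; have n0 : 0 < nrm q by rewrite enorm2_gt0.
by rewrite enorm2Z enorm2_rot gtr0_norm ?invr_gt0 // mulVf // gt_eqF.
Qed.

Lemma rot_normal_dir q : rot (normal_dir q) = - ((nrm q)^-1 *: q).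
Proof. by apply: col2P; rewrite !mxE /= ?mxE /=; ring. Qed.

(** As [det M = 0], every vector of the range has zero [wedge] with [M x0], so the range is the line
    through [M x0] and its orthogonal complement is spanned by the normal. Uniqueness of the foot
    point then evaluates [xget]. *)
Lemma orthproj_range M x0 x : \det M = 0 -> M *m x0 != 0 ->
  orthproj (perp [set y | exists x, y = M *m x]) x =
  dot2 (normal_dir (M *m x0)) x *: normal_dir (M *m x0).
Proof.
move=> d0 q0; set q := M *m x0 in q0 *.
have nq : 0 < nrm q by rewrite enorm2_gt0.
set V := [set y | _].
have Vq : V q by exists x0.
have pV : perp V (rot q).
  move=> _ [y ->]; rewrite (_ : dot2 _ _ = wedge q (M *m y)).
    by rewrite wedge_mulmx d0 mul0r.
  by rewrite !dot2E rotE0 rotE1 /wedge; ring.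
have pE y : perp V y -> y = (wedge q y / nrm q ^+ 2) *: rot q.
  by move=> /(_ q Vq) h; rewrite {1}(decomp_rot y q0) h mul0r scale0r add0r.
have rr : dot2 (rot q) (rot q) = nrm q ^+ 2 by rewrite -enorm2_sqr enorm2_rot.
have qn0 : nrm q != 0 by rewrite gt_eqF.
set p := dot2 _ x *: _; have pE' : p = (dot2 (rot q) x / nrm q ^+ 2) *: rot q.
  by rewrite /p /normal_dir dot2Zl scalerA; congr (_ *: _); field.
apply: xget_unique.
  split; first by move=> y Vy; rewrite pE' dot2Zl (pV _ Vy) mulr0.
  move=> w /pE ->; rewrite dot2C dot2Zl dot2C dot2Dl -scaleN1r dot2Zl pE' dot2Zl rr.
  by rewrite (dot2C x) divfK ?expf_neq0 // mulN1r subrr mulr0.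
move=> y [Wy hy]; rewrite (pE y Wy) pE'; congr (_ *: _); congr (_ / _).
have := hy _ pV; rewrite dot2Dl {1}(pE y Wy) -scaleN1r scalerA dot2Zl rr.
rewrite mulN1r mulNr divfK ?expf_neq0 // (dot2C x) => /eqP.
by rewrite subr_eq0 => /eqP.
Qed.

Lemma normal_dir_dist q q' : q != 0 -> q' != 0 ->
  nrm (normal_dir q' - normal_dir q) <= 2 * nrm (q' - q) / nrm q.
Proof.
move=> q0 q'0; have a0 : 0 < nrm q by rewrite enorm2_gt0.
have b0 : 0 < nrm q' by rewrite enorm2_gt0.
set a := nrm q in a0 *; set b := nrm q' in b0 *.
have -> : normal_dir q' - normal_dir q =
   (b^-1 - a^-1) *: rot q' + a^-1 *: rot (q' - q).
  by apply: col2P; rewrite /normal_dir -/a -/b !mxE /= ?mxE /=; ring.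
apply: le_trans (enorm2D _ _) _; rewrite !enorm2Z !enorm2_rot.
have ab : `|a - b| <= nrm (q' - q).
  rewrite ler_norml; apply/andP; split.
    by have := enorm2D (q' - q) q; rewrite subrK -/a -/b; lra.
  have := enorm2D (q - q') q'; rewrite subrK -/a -/b -(enorm2N (q - q')) opprB; lra.
have -> : `|b^-1 - a^-1| * b = `|a - b| / a.
  have -> : b^-1 - a^-1 = (a - b) / (a * b) by field; rewrite !gt_eqF.
  rewrite normrM normfV [`|a * b|]gtr0_norm ?mulr_gt0 //; field; by rewrite !gt_eqF.
rewrite [`|a^-1|]gtr0_norm ?invr_gt0 // (mulrC a^-1) -mulrDl ler_pM2r ?invr_gt0 //.
by lra.
Qed.

Lemma closure_frobP (F : set 'M[R]_2) M :
  closure F M <-> (forall e : R, 0 < e -> exists2 G, F G & frob (G - M) < e).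
Proof.
split=> [cl e e0|h B].
  by have [G [FG hG]] := cl _ (near_frob M e0); exists G.
move=> /nbhs_ballP[e /= e0 hB]; have [G FG hG] := h _ e0; exists G; split=> //.
apply: hB; split=> // i j; apply: le_lt_trans hG.
by rewrite -[X in `|X|]opprB normrN; have := coord_le_frob (G - M) i j; rewrite !mxE.
Qed.

(** The box is a continuous image of a product of segments, one for each entry. *)
Lemma mx_box_compact (a : R) : compact [set M : 'M[R]_2 | forall i j, `|M i j| <= a].
Proof.
pose f (u : 'rV[R]_(2 * 2)) : 'M[R]_2 := \matrix_(i, j) u 0 (mxvec_index i j).
pose K := [set u : 'rV[R]_(2 * 2) | forall i, `[(- a), a]%classic (u 0 i)].
have cK : compact K.
  exact: (@rV_compact R (2 * 2) (fun=> `[(- a), a]%classic) (fun=> @segment_compact _ _ _)).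
have cf : continuous f.
  move=> u B /nbhs_ballP[e /= e0 hB]; apply/nbhs_ballP; exists e => //= w [_ hw].
  by apply: hB; split=> // i j; rewrite !mxE; exact: hw.
have := continuous_compact (continuous_subspaceT cf) cK; congr compact.
apply/seteqP; split=> [_ [u Ku <-] i j|M hM].
  by rewrite mxE; have := Ku (mxvec_index i j); rewrite /= in_itv /= ler_norml.
exists (mxvec M); last by apply/matrixP => i j; rewrite mxE mxvecE.
by move=> k; case/mxvec_indexP: k => i j; rewrite mxvecE /= in_itv /= -ler_norml.
Qed.

End Directions.

(** * Normalised Furstenberg matrices *)

Section Furstenberg.
Variables (R : realType) (N : nat) (A : 'I_N -> 'M[R]_2).
Local Notation nrm := (@enorm2 R).
Hypothesis unitA : forall i, A i \in unitmx.
Hypothesis domA : dominated A.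

(** Normalised representatives of the Furstenberg directions. At norm one, having rank one is the
    closed condition [det M = 0], which makes the set compact. *)
Definition furst_unit : set 'M[R]_2 :=
  [set M | [/\ closure (furst_mats A) M, frob M = 1 & \det M = 0]].

Definition mx_range (M : 'M[R]_2) : set 'cV[R]_2 := [set y | exists x, y = M *m x].

Lemma furst_dirsE V : furst_dirs A V <-> exists2 M, furst_unit M & V = mx_range M.
Proof.
split=> [[M [cM [/rank1_det[M0 d0] ->]]]|[M [cM f1 d0] ->]]; last first.
  by exists M; split=> //; split=> //; apply/rank1_det; rewrite -frob_gt0 f1.
have f0 : 0 < frob M by rewrite frob_gt0.
have fn0 : frob M != 0 by rewrite gt_eqF.
exists ((frob M)^-1 *: M).
  split.
  - apply/closure_frobP => e e0.
    have [G [c [w eG]] hG] := (closure_frobP _ _).1 cM _ (mulr_gt0 e0 f0).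
    exists ((frob M)^-1 *: G); first by exists ((frob M)^-1 * c), w; rewrite eG scalerA.
    by rewrite -scalerBr frobZ gtr0_norm ?invr_gt0 // mulrC ltr_pdivrMr.
  - by rewrite frobZ gtr0_norm ?invr_gt0 // mulVf.
  - by rewrite detZ d0 mulr0.
apply/seteqP; split=> _ [x ->].
  by exists (frob M *: x); rewrite -scalemxAr scalemxAl scalerA mulfV // scale1r.
by exists ((frob M)^-1 *: x); rewrite -scalemxAr scalemxAl.
Qed.

Lemma furst_unit_compact : compact furst_unit.
Proof.
apply: (subclosed_compact _ (@mx_box_compact R 1)); last first.
  by move=> M [_ f1 _] i j; rewrite -f1 coord_le_frob.
move=> M /closure_frobP h; split.
- apply/closure_frobP => e e0; have e2 : 0 < e / 2 by rewrite divr_gt0.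
  have [G [/closure_frobP cG _ _] GM] := h _ e2; have [H FH HG] := cG _ e2.
  exists H => //; rewrite -(subrK G H) -addrA; apply: le_lt_trans (frobD _ _) _.
  by rewrite [ltRHS]splitr ltrD.
- apply/eqP; rewrite eq_le; apply/andP; split; apply/ler_addgt0Pr => e e0;
    have [G [_ G1 _] GM] := h _ e0.
    by have := frobD (M - G) G; rewrite subrK -opprB frobN G1; lra.
  by have := frobD (G - M) M; rewrite subrK G1; lra.
apply/eqP; rewrite -normr_le0; apply/ler_addgt0Pr => e e0; rewrite add0r.
have f0 := frob_ge0 M.
have [G [_ G1 dG] GM] := h _ (divr_gt0 e0 (ltr_pwDr ltr01 f0)).
have := det_dist_le M G; rewrite dG subr0 G1 -opprB frobN => /le_trans; apply.
by rewrite -ler_pdivlMr ?ltW // ltr_pwDr.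
Qed.

Lemma prod_inv_rev (w : seq 'I_N) :
  \prod_(i <- w) (A i)^-1 = invmx (wordmx A (rev w)).
Proof.
have u z : wordmx A z \in unitmx.
  by rewrite unitmxE unitfE wordmx_det_neq0 // => i; exact: det_letter_neq0.
suff h : wordmx A (rev w) *m \prod_(i <- w) (A i)^-1 = 1%:M.
  by rewrite -[LHS](mulKmx (u (rev w))) h mulmx1.
elim: w => [|i w ih]; first by rewrite big_nil wordmx_nil mulmx1.
rewrite rev_cons -cats1 wordmx_cat big_cons wordmx_cons wordmx_nil mulmx1.
by rewrite -mulmxA (mulmxA (A i)) mulmxV // mul1mx ih.
Qed.

(** Powers of one letter suffice: domination bounds the determinants of their normalised inverses by
    [C * tau ^+ n], so a cluster point is singular of norm one. *)
Lemma furst_unit_neq0 : (0 < N)%N -> furst_unit !=set0.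
Proof.
move=> N0; pose i0 := Ordinal N0.
have u z : wordmx A z \in unitmx.
  by rewrite unitmxE unitfE wordmx_det_neq0 // => i; exact: det_letter_neq0.
pose I n := invmx (wordmx A (rev (nseq n i0))).
pose G n := (frob (I n))^-1 *: I n.
have f0 n : 0 < frob (I n).
  rewrite frob_invmx // mulr_gt0 ?frob_wordmx_gt0 // invr_gt0 normr_gt0.
  by have := u (rev (nseq n i0)); rewrite unitmxE unitfE.
have G1 n : frob (G n) = 1.
  by rewrite /G frobZ gtr0_norm ?invr_gt0 // mulVf // gt_eqF.
have GF n : furst_mats A (G n).
  by exists (frob (I n))^-1, (nseq n i0); rewrite prod_inv_rev.
have [C [tau [C0 /andP[t0 t1] dom]]] := dominated_det domA.
have dG n : `|\det (G n)| <= C * tau ^+ n.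
  have := dom (rev (nseq n i0)); rewrite size_rev size_nseq -frob_sqr.
  have d0 : \det (wordmx A (rev (nseq n i0))) != 0.
    by have := u (rev (nseq n i0)); rewrite unitmxE unitfE.
  have fw := frob_wordmx_gt0 unitA (rev (nseq n i0)).
  rewrite /G detZ normrM ger0_norm; last by rewrite exprn_ge0 ?invr_ge0 ?(ltW (f0 n)).
  rewrite /I frob_invmx // det_inv normfV.
  set D := `|\det _|; set f := frob _ in fw *.
  have D0 : 0 < D by rewrite normr_gt0.
  rewrite -ler_pdivrMr ?exprn_gt0 // => h; apply: le_trans h.
  rewrite le_eqVlt; apply/orP; left; apply/eqP; field.
  by rewrite !gt_eqF.
have [M [_ clM]] : [set M : 'M[R]_2 | forall i j, `|M i j| <= 1] `&` cluster (G @ \oo) !=set0.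
  apply: mx_box_compact; exists 0%N => //= n _ i j.
  by rewrite -(G1 n) coord_le_frob.
have lim (e : R) (n0 : nat) : 0 < e -> exists2 n, (n0 <= n)%N & frob (G n - M) < e.
  move=> e0.
  have [|_ [[n nn0 <-] h]] :=
      clM [set G n | n in [set n | (n0 <= n)%N]] _ _ (near_frob M e0).
    by exists n0 => // n /= hn; exists n.
  by exists n.
exists M; split.
- by apply/closure_frobP => e e0; have [n _ h] := lim e 0%N e0; exists (G n).
- apply/eqP; rewrite eq_le; apply/andP; split; apply/ler_addgt0Pr => e e0;
    have [n _ h] := lim e 0%N e0.
    by have := frobD (M - G n) (G n); rewrite subrK -opprB frobN G1; lra.
  by have := frobD (G n - M) M; rewrite subrK G1; lra.
apply/eqP; rewrite -normr_le0; apply/ler_addgt0Pr => e e0; rewrite add0r.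
have f1 := frob_ge0 M.
have e2 : 0 < e / 2 by rewrite divr_gt0.
have [n0 hn0] : exists n0, forall n, (n0 <= n)%N -> C * tau ^+ n < e / 2.
  have ti : 1 < tau^-1 by rewrite invf_gt1.
  have [n1 hn1] := exp_beats_linear (2 * C / e) ltr01 ti; exists n1 => n /hn1.
  rewrite mul1r exprVn => h.
  have tn : 0 < tau ^+ n by rewrite exprn_gt0.
  have : 2 * C / e < tau ^- n.
    apply: le_lt_trans h; rewrite ler_peMr ?lerDl // divr_ge0 ?mulr_ge0 ?(ltW C0) ?(ltW e0) //.
  rewrite -[ltRHS]mul1r ltr_pdivlMr // mulrAC ltr_pdivrMr // mul1r; lra.
have [n nn0 h] := lim _ n0 (divr_gt0 e2 (ltr_pwDr ltr01 f1)).
have := det_dist_le M (G n); rewrite G1 -(opprB (G n) M) frobN => h2.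
have h3 : frob (G n - M) * (frob M + 1) <= e / 2.
  by rewrite -ler_pdivlMr ?ltW // ltr_pwDr.
have := hn0 n nn0; have := dG n; have := ler_normD (\det M - \det (G n)) (\det (G n)).
rewrite subrK; lra.
Qed.

(* [W G = c] gives [W q = c x0 - W (G - M) x0], and [|c|] is small against [frob W]
   because [\det G] is close to [\det M = 0]. *)
Lemma furst_contracted M x0 (r : R) : furst_unit M -> nrm x0 = 1 -> 0 < r ->
  exists w, nrm (wordmx A w *m (M *m x0)) <= r * frob (wordmx A w).
Proof.
move=> [/closure_frobP cM M1 d0] x1 r0.
(* The bound 1/2 keeps [frob G >= 1/2], whence [e * (frob G + 1) <= 3 * e * frob G]. The two error
   terms then sum to at most [4 * e * frob W], which the bound [r / 4] absorbs. *)
pose e := Num.min (2^-1) (r / 4).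
have e0 : 0 < e by rewrite lt_min invr_gt0 ltr0n /= divr_gt0.
have e1 : e <= 2^-1 by rewrite ge_min lexx.
have e4 : e <= r / 4 by rewrite ge_min lexx orbT.
have [G [c [w eG]] hG] := cM _ e0.
exists (rev w); set W := wordmx A (rev w).
have uW : W \in unitmx.
  by rewrite unitmxE unitfE wordmx_det_neq0 // => i; exact: det_letter_neq0.
have dW : 0 < `|\det W| by rewrite normr_gt0; move: uW; rewrite unitmxE unitfE.
have W0 : 0 < frob W := frob_wordmx_gt0 unitA _.
have {}eG : G = c *: invmx W by rewrite eG prod_inv_rev.
have f2 : 2^-1 <= frob G.
  have := frobD (M - G) G; rewrite subrK M1 -opprB frobN; lra.
have fG : frob G = `|c| * (`|\det W|^-1 * frob W) by rewrite eG frobZ frob_invmx.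
have dG : `|\det G| = `|c| ^+ 2 * `|\det W|^-1.
  by rewrite eG detZ normrM normrX det_inv normfV.
have := det_dist_le G M; rewrite d0 subr0 M1 => h.
have hdG : `|\det G| <= 3 * e * frob G.
  apply: le_trans h _; apply: le_trans (_ : e * (3 * frob G) <= _).
    by apply: ler_pM; rewrite ?frob_ge0 ?addr_ge0 ?frob_ge0 ?(ltW hG) //; lra.
  by rewrite mulrA (mulrC e).
have hc : `|c| <= 3 * e * frob W.
  have [->|c0] := eqVneq c 0.
    by rewrite normr0 !mulr_ge0 ?(ltW e0) ?(ltW W0).
  have c0' : 0 < `|c| by rewrite normr_gt0.
  move: hdG; rewrite dG fG expr2.
  rewrite (_ : 3 * e * _ = `|c| * `|\det W|^-1 * (3 * e * frob W)); last by ring.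
  by rewrite mulrAC ler_pM2l // mulr_gt0 ?invr_gt0.
have -> : W *m (M *m x0) = c *: x0 - W *m ((G - M) *m x0).
  by rewrite mulmxBl mulmxBr {1}eG -scalemxAl -scalemxAr mulKVmx // opprB addrC subrK.
apply: le_trans (enorm2D _ _) _; rewrite enorm2N enorm2Z x1 mulr1.
have := enorm2_mulmx W ((G - M) *m x0).
have := enorm2_mulmx (G - M) x0; rewrite x1 mulr1 => h1 h2.
have h3 : frob W * nrm ((G - M) *m x0) <= frob W * e.
  by rewrite ler_pM2l //; lra.
have h4 : frob W * e <= frob W * (r / 4) by rewrite ler_pM2l.
lra.
Qed.

(** * Upper semicontinuity and the maximum *)

Section Maximum.
Variables (s : R) (X : set 'cV[R]_2).
Hypotheses (s0 : 0 < s) (s1 : s <= 1) (cX : compact X).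

Definition proj_content (M : 'M[R]_2) : \bar R :=
  Hcontent s (orthproj (perp (mx_range M)) @` X).

Lemma proj_contentE M x0 : \det M = 0 -> M *m x0 != 0 ->
  proj_content M = Hcontent s (lineproj X (normal_dir (M *m x0))).
Proof.
move=> d0 q0; rewrite /proj_content /lineproj; congr Hcontent.
by apply: eq_imagel => x _; exact: orthproj_range.
Qed.

Lemma furst_unit_column M : furst_unit M -> exists x0, [/\ nrm x0 = 1, M *m x0 != 0 &
  2^-1 <= nrm (M *m x0)].
Proof.
move=> [_ M1 _]; have [x0 x1 h] := frob_attained M; rewrite M1 in h.
have h2 : 2^-1 <= nrm (M *m x0) by lra.
exists x0; split=> //; rewrite -enorm2_gt0; lra.
Qed.

Lemma proj_content_usc M (eta : R) : furst_unit M -> (proj_content M < eta%:E)%E ->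
  \forall M' \near M, furst_unit M' -> (proj_content M' < eta%:E)%E.
Proof.
move=> FM; have [x0 [x1 q0 q2]] := furst_unit_column FM.
have [_ _ dM] := FM.
rewrite (proj_contentE dM q0) => /(strips_of_Hcontent_lt s0 cX (normal_dir_norm q0)).
move=> /(strip_cover_near s1 cX)[r r0 hr].
(* Since [|M x0| >= 1/2], the first bound keeps [M' x0] nonzero, and [normal_dir_dist] turns the
   second into a move of the normal by at most [4 * e <= r]. *)
pose e := Num.min (2^-1) (r / 4).
have e0 : 0 < e by rewrite lt_min invr_gt0 ltr0n /= divr_gt0.
have e1 : e <= 2^-1 by rewrite ge_min lexx.
have e4 : e <= r / 4 by rewrite ge_min lexx orbT.
apply: filterS (near_frob M e0) => M' hM' [_ _ d'].
have dq : nrm (M' *m x0 - M *m x0) < e.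
  rewrite -mulmxBl; apply: le_lt_trans hM'.
  by have := enorm2_mulmx (M' - M) x0; rewrite x1 mulr1.
have q'0 : M' *m x0 != 0.
  rewrite -enorm2_gt0; have := enorm2D (M *m x0 - M' *m x0) (M' *m x0).
  by rewrite subrK -opprB enorm2N; lra.
rewrite (proj_contentE d' q'0); apply: Hcontent_lt_of_strips => //.
  exact: normal_dir_norm.
apply: hr; apply: le_trans (normal_dir_dist q0 q'0) _.
rewrite ler_pdivrMr; last by lra.
have := ler_wpM2l (ltW r0) q2; lra.
Qed.

Lemma proj_content_bounded : exists eta : R, forall M, furst_unit M ->
  (proj_content M < eta%:E)%E.
Proof.
have [R0 R00 hR0] := compact_enorm2_bounded cX.
exists ((2 * R0) `^ s + 1) => M FM; have [x0 [x1 q0 _]] := furst_unit_column FM.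
have [_ _ dM] := FM; rewrite (proj_contentE dM q0); set n := normal_dir _.
have n1 : nrm n = 1 by exact: normal_dir_norm.
apply: Hcontent_lt_of_strips => //.
exists unit, (fun=> [set dot2 n x | x in X]), (fun=> 2 * R0); split.
- by move=> x Xx; exists tt; exists x.
- move=> _ _ _ [x Xx <-] [y Xy <-].
  rewrite (_ : _ - _ = dot2 n (x - y)); last by rewrite !dot2E !mxE; ring.
  apply: le_trans (dot2_le _ _) _; rewrite n1 mul1r.
  apply: le_trans (enorm2D _ _) _; rewrite enorm2N.
  by have := hR0 _ Xx; have := hR0 _ Xy; lra.
- by move=> _; rewrite mulr_gt0.
by rewrite big_const card_unit /= addr0 ltrDl.
Qed.

Lemma proj_content_max : (0 < N)%N -> exists2 M0, furst_unit M0 &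
  forall M, furst_unit M -> (proj_content M <= proj_content M0)%E.
Proof.
move=> N0; have [M1 FM1] := furst_unit_neq0 N0.
have [eta heta] := proj_content_bounded.
apply: contrapT => noM.
have lt M : furst_unit M -> exists2 M', furst_unit M' & (proj_content M < proj_content M')%E.
  move=> FM; apply: contrapT => h; apply: noM; exists M => // M' FM'.
  by rewrite leNgt; apply/negP => l; apply: h; exists M'.
pose T := ereal_sup [set proj_content M | M in furst_unit].
have ubT M : furst_unit M -> (proj_content M <= T)%E.
  by move=> FM; apply: ereal_sup_ubound; exists M.
have c0 M : (0 <= proj_content M)%E.
  apply: le_ereal_inf_tmp => _ [U [_ ->]]; apply: nneseries_ge0 => i _ _; exact: poweR_ge0.
have Tfin : T \is a fin_num.
  rewrite ge0_fin_numE; last exact: le_trans (c0 M1) (ubT _ FM1).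
  apply: le_lt_trans (_ : (eta%:E < +oo)%E); last by rewrite ltry.
  by apply: ge_ereal_sup => _ [M FM <-]; exact/ltW/heta.
have [t Tt] : exists t, T = t%:E by exists (fine T); rewrite fineK.
have ltT M : furst_unit M -> (proj_content M < T)%E.
  by move=> FM; have [M' FM' l] := lt M FM; exact: lt_le_trans l (ubT _ FM').
(* Near-covering along the levels [u] tending to [t] from below: if the supremum were not attained,
   every matrix would have a neighbourhood bounded by a level below [t], so a single level below [t]
   would bound all contents. *)
have := (compact_near_coveringP _).1 furst_unit_compact R (t^'-)
  (fun u M => furst_unit M -> (proj_content M <= u%:E)%E) _ _.
case=> [M FM|].
  have := ltT M FM; rewrite Tt => l.
  have pf : proj_content M \is a fin_num by rewrite ge0_fin_numE // (lt_trans l) ?ltry.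
  move: l; rewrite -(fineK pf) lte_fin; set p := fine _ => l.
  pose u0 := (p + t) / 2.
  have pu : (proj_content M < u0%:E)%E by rewrite -(fineK pf) lte_fin /u0 -/p; lra.
  exists ([set M' | furst_unit M' -> (proj_content M' < u0%:E)%E], [set u | u0 < u]) => /=.
    split; first exact: proj_content_usc.
    by apply: nbhs_left_gt; rewrite /u0; lra.
  move=> [M' u] /= [h1 h2] /h1 /ltW /le_trans; apply; rewrite lee_fin; exact: ltW.
move=> d /= d0 hd.
have : (T <= (t - d / 2)%:E)%E.
  apply: ge_ereal_sup => _ [M FM <-]; apply: (hd (t - d / 2)) => //=.
    by rewrite opprB addrC subrK gtr0_norm; lra.
  by lra.
rewrite Tt lee_fin; lra.
Qed.

End Maximum.

End Furstenberg.

(** * Self-affine sets *)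

Lemma opnorm_bound (R : realType) (M : 'M[R]_2) (x : 'cV[R]_2) :
  enorm2 (M *m x) <= opnorm M * enorm2 x.
Proof.
have [->|x0] := eqVneq x 0; first by rewrite mulmx0 enorm20 mulr0.
have n0 : 0 < enorm2 x by rewrite enorm2_gt0.
rewrite -ler_pdivrMr //; apply: ub_le_sup.
  exists (frob M) => _ [y [y1 ->]].
  by have := enorm2_mulmx M y; rewrite y1 mulr1.
exists ((enorm2 x)^-1 *: x); split.
  by rewrite enorm2Z gtr0_norm ?invr_gt0 // mulVf // gt_eqF.
by rewrite -scalemxAr enorm2Z gtr0_norm ?invr_gt0 // mulrC.
Qed.

(** * Propagation of covers along the tree of words *)

Section WordCovers.
Variables (R : realType) (N : nat) (P : seq 'I_N -> R -> Prop) (b : seq 'I_N -> R) (H : nat).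
Hypothesis P_split : forall u t, (forall a, P (rcons u a) (t a)) -> P u (\sum_a t a).

Local Notation Phi u := (tail_sum b (H - size u) u).

(** At a fixed horizon [H] the weight [Phi] is additive over children, as the mass of cylinders
    would be. *)
Lemma tail_sum_split u : (size u < H)%N -> Phi u = \sum_a Phi (rcons u a).
Proof.
move=> hu; rewrite -[in LHS](subnSK hu) /=; apply: eq_bigr => a _.
by rewrite size_rcons.
Qed.

Lemma cover_from_level n (x : R) : (n <= H)%N ->
  (forall u, size u = n -> P u (x * Phi u)) ->
  forall u, (size u <= n)%N -> P u (x * Phi u).
Proof.
move=> nH h u; move e : (n - size u)%N => m; elim: m u e => [|m ih] u e hu.
  by apply: h; apply/eqP; rewrite eqn_leq hu -subn_eq0 e.
have lt : (size u < n)%N by rewrite -subn_gt0 e.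
rewrite tail_sum_split ?(leq_trans lt) // mulr_sumr; apply: P_split => a.
by apply: ih; rewrite size_rcons // subnS e.
Qed.

(** Along the path from [u] to [u ++ w], all children off the path are covered at rate [x] and only
    the end of the path at rate [y]; by additivity of [Phi] the saving is
    [(x - y) * Phi (u ++ w)]. *)
Lemma cover_with_better_word w (x y : R) u : (size u + size w <= H)%N ->
  (forall u', (size u <= size u' <= size u + size w)%N -> P u' (x * Phi u')) ->
  P (u ++ w) (y * Phi (u ++ w)) ->
  P u (x * Phi u - (x - y) * Phi (u ++ w)).
Proof.
elim: w u => [|a0 w ih] u hu hx hy.
  rewrite cats0 in hy *; rewrite (_ : _ - _ = y * Phi u) //; ring.
have lt : (size u < H)%N by apply: leq_trans hu; rewrite /= addnS ltnS leq_addr.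
pose t a := if a == a0 then x * Phi (rcons u a0) - (x - y) * Phi (u ++ a0 :: w)
            else x * Phi (rcons u a).
have -> : x * Phi u - (x - y) * Phi (u ++ a0 :: w) = \sum_a t a.
  rewrite (tail_sum_split lt) (bigD1 a0) //= [RHS](bigD1 a0) //= {1}/t eqxx mulrDr.
  rewrite addrAC; congr (_ + _); rewrite mulr_sumr; apply: eq_bigr => a /negbTE ne.
  by rewrite /t ne.
apply: P_split => a; rewrite /t; case: eqP => [->|_].
  rewrite -cat_rcons; apply: ih.
  - by rewrite size_rcons addSnnS.
  - move=> u' /andP[h1 h2]; apply: hx; rewrite size_rcons in h1 h2.
    by rewrite ltnW //= addnS -addSn.
  - by rewrite cat_rcons.
by apply: hx; rewrite size_rcons leqnSn /= addnS ltnS leq_addr.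
Qed.

End WordCovers.

(** * The covering estimate for the self-affine set *)

Section SelfAffine.
Variables (R : realType) (N : nat) (A : 'I_N -> 'M[R]_2) (v : 'I_N -> 'cV[R]_2).
Variables (X : set 'cV[R]_2) (s : R).
Hypotheses (N2 : (2 <= N)%N) (unitA : forall i, A i \in unitmx).
Hypothesis contrA : forall i, opnorm (A i) < 1.
Hypotheses (cX : compact X) (fixX : X = \bigcup_i [set A i *m x + v i | x in X]).
Hypotheses (domA : dominated A) (dimA : is_affdim A s) (s1 : s <= 1).
Local Notation nrm := (@enorm2 R).

Let N0 : (0 < N)%N. Proof. exact: ltnW. Qed.

Definition phi (w : seq 'I_N) (x : 'cV[R]_2) : 'cV[R]_2 :=
  foldr (fun i y => A i *m y + v i) x w.

Lemma phi_sub w x y : phi w x - phi w y = wordmx A w *m (x - y).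
Proof.
elim: w => [|i w ih] /=; first by rewrite wordmx_nil mul1mx.
by rewrite opprD addrACA subrr addr0 -mulmxBr ih wordmx_cons mulmxA.
Qed.

Lemma phi_split w : phi w @` X = \bigcup_a (phi (rcons w a) @` X).
Proof.
apply/seteqP; split=> [_ [x Xx <-]|_ [a _ [x Xx <-]]].
  move: Xx; rewrite {1}fixX => -[a _ [y Xy <-]].
  by exists a => //; exists y => //; rewrite /phi foldr_rcons.
exists (A a *m x + v a); last by rewrite /phi foldr_rcons.
by rewrite fixX; exists a => //; exists x.
Qed.

Lemma word_shrink (e : R) : 0 < e -> exists n0, forall w, (n0 <= size w)%N ->
  frob (wordmx A w) <= e.
Proof.
(* The default value 1/2 keeps [rho] positive, so that [rho^-1] can serve as a growth rate. *)
move=> e0; pose rho := \big[Num.max/2^-1]_i opnorm (A i).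
have r1 : rho < 1.
  by apply: bigmax_lt => [|i _]; [rewrite invf_lt1 // ltr1n|exact: contrA].
have r0 : 0 < rho by apply: lt_le_trans (bigmax_ge_id _ _ _ _); rewrite invr_gt0.
have hr i : opnorm (A i) <= rho by exact: le_bigmax.
have h w x : nrm (wordmx A w *m x) <= rho ^+ size w * nrm x.
  elim: w => [|i w ih]; first by rewrite wordmx_nil mul1mx mul1r.
  rewrite wordmx_cons -mulmxA; apply: le_trans (opnorm_bound _ _) _.
  apply: le_trans (ler_wpM2r (enorm2_ge0 _) (hr i)) _.
  by rewrite exprS -mulrA ler_pM2l.
have ri : 1 < rho^-1 by rewrite invf_gt1.
have [n0 hn0] := exp_beats_linear (2 / e) ltr01 ri; exists n0 => w /hn0.
rewrite mul1r exprVn => hw.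
have rn : 0 < rho ^+ size w by rewrite exprn_gt0.
have : 2 / e < rho ^- size w.
  by apply: le_lt_trans hw; rewrite ler_peMr ?lerDl // divr_ge0 // ltW.
rewrite -[ltRHS]mul1r ltr_pdivlMr // mulrAC ltr_pdivrMr // mul1r => h2.
apply: le_trans (frob_le_cols (K := rho ^+ size w) _) (ltW h2) => x x1.
by have := h w x; rewrite x1 mulr1.
Qed.

(** At exponent 0 the pressure sum is [N ^ n], whose growth rate [ln N] is positive. *)
Lemma affdim_gt0 : 0 < s.
Proof.
have [s0 [hs _]] := dimA; rewrite lt_def s0 andbT; apply/eqP => se.
have p0 n : pressure_sum A s n = N%:R ^+ n.
  rewrite /pressure_sum (eq_bigr (fun=> 1)) => [|w _]; last first.
    by rewrite /svf se ler01 powRr0.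
  by rewrite sumr_const card_tuple card_ord natrX.
have NR : 1 < N%:R :> R by rewrite ltr1n.
have : ln N%:R <= 0 :> R.
  apply: (sublinear_le0 (n := 1) (c := 0) _ hs) => // j.
  rewrite p0 mul1n lnXn ?(lt_trans ltr01) // subr0 mulr_natl; exact: ler_norm.
by rewrite leNgt ln_gt0.
Qed.

Let s0 : 0 < s := affdim_gt0.

Let b w : R := frob (wordmx A w) `^ s.

Let b_gt0 w : 0 < b w. Proof. by rewrite powR_gt0 // frob_wordmx_gt0. Qed.

(** For [s <= 1] the singular value function is [sv1 ^ s], which differs from [b] by a factor at
    most 2, so zero pressure passes to the sums of [b]. *)
Lemma gibbs_bounds : exists k : R, [/\ 0 < k,
  forall u w, k * (b u * b w) <= b (u ++ w),
  forall n, 1 <= tail_sum b n [::] & forall n, k * tail_sum b n [::] <= 1].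
Proof.
have [k0 k00 hk0] := quasi_multiplicative unitA domA.
have bM u w : b (u ++ w) <= b u * b w.
  rewrite /b -powRM ?frob_ge0 // ge0_ler_powR ?nnegrE ?mulr_ge0 ?frob_ge0 ?(ltW s0) //.
  by rewrite wordmx_cat frob_mul.
have kb u w : k0 `^ s * (b u * b w) <= b (u ++ w).
  rewrite /b -!powRM ?mulr_ge0 ?frob_ge0 ?(ltW k00) //.
  by rewrite ge0_ler_powR ?nnegrE ?mulr_ge0 ?frob_ge0 ?(ltW s0) ?(ltW k00).
have k1 : 0 < k0 `^ s by rewrite powR_gt0.
pose p n := pressure_sum A s n.
have pE n : p n = tail_sum (fun w => sv1 (wordmx A w) `^ s) n [::].
  by rewrite -tail_sum_tuple; apply: eq_bigr => w _; rewrite /svf s1.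
have lo w : sv1 (wordmx A w) `^ s <= 1 * b w.
  rewrite mul1r ge0_ler_powR ?nnegrE ?sv1_ge0 ?frob_ge0 ?(ltW s0) //; exact: sv1_le_frob.
have up w : b w <= 2 * sv1 (wordmx A w) `^ s.
  apply: le_trans (_ : (2 * sv1 (wordmx A w)) `^ s <= _).
    rewrite ge0_ler_powR ?nnegrE ?mulr_ge0 ?sv1_ge0 ?frob_ge0 ?(ltW s0) //.
    exact: frob_le_sv1.
  rewrite powRM ?sv1_ge0 // ler_wpM2r ?powR_ge0 // ler1_powR // ler1n //.
have Zp n : tail_sum b n [::] <= 2 * p n by rewrite pE; exact: tail_sum_le.
have pZ n : p n <= tail_sum b n [::] by rewrite pE -[leRHS]mul1r; exact: tail_sum_le.
have pp n : 0 < p n.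
  have := lt_le_trans (tail_sum_gt0 N0 b_gt0 n [::]) (Zp n); lra.
have [_ [hs _]] := dimA.
have hb := partition_bounds N0 k1 b_gt0 bM kb pp pZ Zp hs.
by exists (k0 `^ s); split=> // n; have [] := hb n.
Qed.

(* Every word can be continued by [w], whose images are covered more cheaply than by the
   trivial bound. Peeling off these continuations at each of [T] stages leaves an
   exponentially small proportion [(1 - beta) ^+ T] of the Gibbs weight for the trivial bound. *)
Lemma Hdelta_le_strips : exists2 K : R, 0 < K & forall M x0 (eta delta : R),
  furst_unit A M -> nrm x0 = 1 -> M *m x0 != 0 ->
  strip_cover s X (normal_dir (M *m x0)) eta -> 0 < delta ->
  (Hdelta s delta X <= (K * eta)%:E)%E.
Proof.
have [k [k0 kb Z1 kZ]] := gibbs_bounds.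
have [k1 k10 hk1] := quasi_multiplicative unitA domA.
(* One factor [1 / k] compares [b] with sums over continuations, the other bounds the total weight
   at the empty word. *)
exists (k ^- 2); first by rewrite invr_gt0 exprn_gt0.
move=> M x0 eta delta FM x1 q0 strip delta0.
have eta0 : 0 <= eta.
  have [I [J [d [_ _ _ /ltW]]]] := strip; apply: le_trans.
  by rewrite sumr_ge0 // => i _; exact: powR_ge0.
set q := M *m x0 in q0 strip; set n := normal_dir q in strip.
have nq : 0 < nrm q by rewrite enorm2_gt0.
have [r [K [r0 K0 hr]]] := strip_cover_image s1 cX (normal_dir_norm q0) strip.
(* The factor [k1] in the tolerance pays for replacing [|A_u| |A_w|] by [|A_uw|], so the contraction
   holds after every prefix [u]; [nq] accounts for normalising [q]. *)
have [w hw] := furst_contracted unitA FM x1 (mulr_gt0 (mulr_gt0 r0 k10) nq).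
rewrite -/q in hw.
have [D D0 hD] := fin_cover_image s cX.
have DK0 : 0 < D + K by rewrite addr_gt0.
have [n0 hn0] := word_shrink (divr_gt0 delta0 DK0).
pose P u t := fin_cover s (phi u @` X) delta t.
have P_split u t : (forall a, P (rcons u a) (t a)) -> P u (\sum_a t a).
  by rewrite /P phi_split; exact: fin_cover_bigcup.
have Ple u t t' : t <= t' -> P u t -> P u t' by move=> tt'; exact: fin_cover_le.
have small u (C : R) : 0 < C <= D + K -> (n0 <= size u)%N -> frob (wordmx A u) * C <= delta.
  move=> /andP[C0 CDK] /hn0; rewrite ler_pdivlMr //; apply: le_trans.
  by rewrite ler_wpM2l ?frob_ge0.
have Ptriv u : (n0 <= size u)%N -> P u (D `^ s * b u).
  move=> hu; rewrite mulrC; apply: fin_cover_le (hD _ _ (phi_sub u)) => //.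
  by apply: small => //; rewrite D0 lerDl ltW.
have Pgood u : (n0 <= size u)%N -> P (u ++ w) (eta * b (u ++ w)).
  move=> hu; rewrite mulrC; apply: fin_cover_le (hr _ _ (phi_sub (u ++ w)) _) => //.
    apply: small; first by rewrite K0 lerDr ltW.
    by rewrite size_cat (leq_trans hu) // leq_addr.
  rewrite rot_normal_dir mulmxN enorm2N -scalemxAr enorm2Z gtr0_norm ?invr_gt0 //.
  rewrite wordmx_cat -mulmxA mulrC ler_pdivrMr //.
  apply: le_trans (enorm2_mulmx _ _) _.
  apply: le_trans (ler_wpM2l (frob_ge0 _) hw) _.
  have := hk1 u w; rewrite wordmx_cat => /(ler_wpM2l (mulr_ge0 (ltW r0) (ltW nq))).
  lra.
have PhiL m u : k * b u <= tail_sum b m u.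
  have := tail_sum_cat_ge kb m u [::]; rewrite cats0; apply: le_trans.
  by rewrite ler_pM2l // ler_peMr // ltW.
have PhiU m u : k * tail_sum b m u <= b u.
  have bM u' w' : b (u' ++ w') <= b u' * b w'.
    rewrite /b -powRM ?frob_ge0 // ge0_ler_powR ?nnegrE ?mulr_ge0 ?frob_ge0 ?(ltW s0) //.
    by rewrite wordmx_cat frob_mul.
  have := tail_sum_cat_le bM m u [::]; rewrite cats0 => /(ler_wpM2l (ltW k0)) /le_trans; apply.
  by rewrite mulrCA ger_pMr // kZ.
(* A lower bound, independent of [u] and the horizon, for the share of the weight of [u] lying under
   [u ++ w]. The three factors [k] come from [PhiL], [kb] and [PhiU]; the minimum with 1/2 keeps
   [1 - beta] positive. *)
pose beta := Num.min (2^-1) (k ^+ 3 * b w).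
have be0 : 0 < beta by rewrite lt_min invr_gt0 ltr0n /= mulr_gt0 // exprn_gt0.
have be1 : beta <= 2^-1 by rewrite ge_min lexx.
have Phiw m m' u : beta * tail_sum b m u <= tail_sum b m' (u ++ w).
  apply: le_trans (PhiL m' (u ++ w)).
  apply: le_trans (_ : k * (k * (b u * b w)) <= _); last by rewrite ler_pM2l.
  apply: le_trans (_ : (k ^+ 3 * b w) * tail_sum b m u <= _).
    by apply: ler_wpM2r; [exact/ltW/tail_sum_gt0|rewrite ge_min lexx orbT].
  rewrite [leLHS](_ : _ = k * k * b w * (k * tail_sum b m u)); last by ring.
  rewrite [leRHS](_ : _ = k * k * b w * b u); last by ring.
  by rewrite ler_wpM2l // ltW // !mulr_gt0.
(* Costs per unit of [Phi]: [a] for the strip covers, [B] for the trivial ones. *)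
pose a := eta / k; pose B := D `^ s / k.
have B0 : 0 <= B by rewrite divr_ge0 ?powR_ge0 // ltW.
have stage H T u : (n0 <= size u)%N -> (size u + T * size w <= H)%N ->
    P u ((a + (1 - beta) ^+ T * B) * tail_sum b (H - size u) u).
  elim: T u => [|T ih] u hu hH.
    apply: Ple (Ptriv u hu); rewrite expr0 mul1r.
    have h1 := PhiL (H - size u)%N u.
    apply: le_trans (_ : B * tail_sum b (H - size u) u <= _).
      rewrite /B -mulrA ler_wpM2l ?powR_ge0 //.
      by rewrite mulrC ler_pdivlMr // mulrC.
    rewrite ler_wpM2r ?lerDr ?divr_ge0 ?(ltW k0) //; exact/ltW/tail_sum_gt0.
  have hH' : (size u + size w <= H)%N.
    by apply: leq_trans hH; rewrite leq_add2l mulSn leq_addr.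
  have hx u' : (size u <= size u' <= size u + size w)%N ->
      P u' ((a + (1 - beta) ^+ T * B) * tail_sum b (H - size u') u').
    move=> /andP[h1 h2]; apply: ih; first exact: leq_trans h1.
    apply: leq_trans hH; rewrite mulSn addnA leq_add2r; exact: h2.
  have hy : P (u ++ w) (a * tail_sum b (H - size (u ++ w)) (u ++ w)).
    apply: Ple (Pgood u hu); rewrite /a -mulrA ler_wpM2l //.
    by rewrite mulrC ler_pdivlMr // mulrC; exact: PhiL.
  apply: Ple (cover_with_better_word P_split hH' hx hy).
  set F := tail_sum b _ u.
  have := Phiw (H - size u)%N (H - size (u ++ w))%N u; rewrite -/F => h.
  have e0 : 0 <= (1 - beta) ^+ T * B.
    by rewrite mulr_ge0 // exprn_ge0 //; lra.
  have := ler_wpM2l e0 h; rewrite exprS; lra.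
have bound T : (Hdelta s delta X <= ((a + (1 - beta) ^+ T * B) / k)%:E)%E.
  have X0 : phi [::] @` X = X by rewrite image_id.
  rewrite -[in leLHS]X0; apply: fin_cover_Hdelta => //; first exact: ltW.
  (* This horizon leaves room for exactly [T] stages of [size w] letters below level [n0], where all
     covering sets are already smaller than [delta]. *)
  pose H := (n0 + T * size w)%N.
  have nH : (n0 <= H)%N by rewrite leq_addr.
  have hu u : size u = n0 -> P u ((a + (1 - beta) ^+ T * B) * tail_sum b (H - size u) u).
    by move=> hu; apply: stage; rewrite hu.
  apply: Ple (cover_from_level P_split nH hu (u := [::]) isT).
  apply: ler_wpM2l; last by rewrite -[leRHS]mul1r ler_pdivlMr // mulrC; exact: kZ.
  have be2 : 0 <= 1 - beta by lra.
  by apply: addr_ge0; [rewrite divr_ge0 // ltW|rewrite mulr_ge0 // exprn_ge0].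
have -> : k ^- 2 * eta = a / k by rewrite /a; field; rewrite gt_eqF.
apply/lee_addgt0Pr => e e0.
have i1 : 1 < (1 - beta)^-1 by rewrite invf_gt1; lra.
have [T hT] := exp_beats_linear (B / (k * e)) ltr01 i1.
apply: le_trans (bound T) _; rewrite -EFinD lee_fin mulrDl lerD2l.
have := hT T (leqnn T); rewrite mul1r exprVn => h.
have c0 : 0 < (1 - beta) ^+ T by rewrite exprn_gt0 //; lra.
have : B / (k * e) < (1 - beta) ^- T.
  apply: le_lt_trans h; apply: ler_peMr; last by rewrite lerDl.
  by apply: divr_ge0 => //; apply: mulr_ge0; exact: ltW.
rewrite -[ltRHS]mul1r ltr_pdivlMr // mulrAC ltr_pdivrMr ?mulr_gt0 // mul1r => h2.
by rewrite ler_pdivrMr // mulrC [leRHS]mulrC ltW.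
Qed.

Lemma Hmeasure_le_proj : exists2 K : R, 0 < K & forall M, furst_unit A M ->
  (Hmeasure s X <= K%:E * proj_content s X M)%E.
Proof.
have [K K0 hK] := Hdelta_le_strips; exists K => // M FM.
have [x0 [x1 q0 _]] := furst_unit_column FM; have [_ _ dM] := FM.
have [eta0 heta0] := proj_content_bounded A s0 cX.
have pf : proj_content s X M \is a fin_num.
  rewrite ge0_fin_numE; first by rewrite (lt_trans (heta0 M FM)) ?ltry.
  apply: le_ereal_inf_tmp => _ [U [_ ->]]; apply: nneseries_ge0 => i _ _; exact: poweR_ge0.
rewrite -(fineK pf) -EFinM; apply/lee_addgt0Pr => e e0; rewrite -EFinD.
have -> : K * fine (proj_content s X M) + e = K * (fine (proj_content s X M) + e / K).
  by field; rewrite gt_eqF.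
(* The extra [e / K] makes the comparison with the content strict, as the extraction of strips
   requires. *)
apply: ge_ereal_sup => _ [delta [delta0 ->]].
apply: (hK _ _ _ _ FM x1 q0 _ delta0); apply: strips_of_Hcontent_lt => //.
  exact: normal_dir_norm q0.
by rewrite -(proj_contentE _ _ dM q0) -(fineK pf) lte_fin ltrDl divr_gt0.
Qed.

End SelfAffine.

Unset Implicit Arguments.
Set Strict Implicit.
Set Printing Implicit Defensive.

Theorem mainTheorem19 (R : realType) (N : nat) (A : 'I_N -> 'M[R]_2)
    (v : 'I_N -> 'cV[R]_2) (X : set 'cV[R]_2) (s : R) :
  (2 <= N)%N ->
  (forall i, A i \in unitmx) ->
  (forall i, opnorm (A i) < 1) ->
  X !=set0 -> compact X ->
  X = \bigcup_i [set A i *m x + v i | x in X] ->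
  dominated A ->
  is_affdim A s -> s <= 1 ->
  (exists V0, furst_dirs A V0 /\
     (forall V, furst_dirs A V ->
        (Hcontent s (orthproj (perp V) @` X) <= Hcontent s (orthproj (perp V0) @` X))%E) /\
     exists c : R, 0 < c /\
        (Hmeasure s X <= c%:E * Hcontent s (orthproj (perp V0) @` X))%E) /\
  ((0 < Hmeasure s X)%E ->
     (0 < ereal_inf [set Hcontent s (orthproj (perp V) @` X) | V in furst_dirs A])%E).
Proof.
move=> N2 unitA contrA _ cX fixX domA dimA s1.
have s0 : 0 < s := affdim_gt0 N2 dimA.
have [K K0 hK] := Hmeasure_le_proj N2 unitA contrA cX fixX domA dimA s1.
have [M0 FM0 maxM0] := proj_content_max unitA domA s0 s1 cX (ltnW N2).
split.
  exists (mx_range M0); split; first by apply/furst_dirsE; exists M0.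
  split; first by move=> _ /furst_dirsE[M FM ->]; exact: maxM0.
  by exists K; split=> //; exact: hK.
(* The estimate holds for every direction with the same [K], not only for the maximising one, so
   [K^-1] times the measure is a lower bound for the infimum. *)
move=> H0; apply: lt_le_trans (_ : (K^-1%:E * Hmeasure s X <= _)%E).
  by rewrite mule_gt0 // lte_fin invr_gt0.
apply: le_ereal_inf_tmp => _ [_ /furst_dirsE[M FM ->] <-].
by rewrite lee_pdivrMl //; exact: hK.
Qed.
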